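(* Let $M$ be a countable, $\omega$-categorical structure. If $\mathrm{Aut}(M)$ is extremely amenable (as a topological group), then the theory of $M$ is G-trivial.
   Context: $\mathrm{Aut}(M)$ carries the pointwise convergence topology. A topological group $G$ is extremely amenable if every continuous action of $G$ on a nonempty compact Hausdorff space has a fixed point. For a complete theory $T$ with monster model $\mathfrak C$ (a $\kappa$-saturated, strongly $\kappa$-homogeneous model for a sufficiently large strong limit $\kappa$), an equivalence relation on a product of fewer than $\kappa$ sorts is bounded if it has fewer than $\kappa$ classes; $E_L$ (on any given product of sorts) is the finest bounded, $\mathrm{Aut}(\mathfrak C)$-invariant equivalence relation. $\mathrm{Autf}_L(\mathfrak C)$ is the group of automorphisms of $\mathfrak C$ preserving all $E_L$-classes on all products of sorts (equivalently, the subgroup generated by all automorphisms fixing pointwise some small elementary submodel of $\mathfrak C$). The Lascar Galois group is $\mathrm{Gal}_L(T)=\mathrm{Aut}(\mathfrak C)/\mathrm{Autf}_L(\mathfrak C)$; it does not depend on the choice of $\mathfrak C$. $T$ is G-trivial if $\mathrm{Gal}_L(T_A)$ is trivial for every finite set $A\subseteq\mathfrak C$, where $T_A$ is the theory of $\mathfrak C$ in the language expanded by constants for the elements of $A$. *)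

(* Defs.v *)
From HB Require Import structures.
From Corelib Require Import RelationClasses.
From mathcomp Require Import all_boot.
From mathcomp Require Import all_classical.
From mathcomp Require Import topology_structure compact separation_axioms
  initial_topology discrete_topology product_topology function_spaces
  supremum_topology.

Set Implicit Arguments.
Unset Strict Implicit.
Unset Printing Implicit Defensive.

Local Open Scope classical_set_scope.
Local Open Scope card_scope.

Record language := Language {
  sorts : Type;
  funs : Type;
  rels : Type;
  farity : funs -> nat;
  fdom : forall f, 'I_(farity f) -> sorts;
  fcod : funs -> sorts;
  rarity : rels -> nat;
  rdom : forall r, 'I_(rarity r) -> sorts }.

Record structure (L : language) := Structure {
  carrier :> sorts L -> Type;
  fun_interp : forall f : funs L,
    (forall i, carrier (fdom (f := f) i)) -> carrier (fcod f);
  rel_interp : forall r : rels L,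
    (forall i, carrier (rdom (r := r) i)) -> Prop }.

Definition elements (L : language) (M : structure L) : Type := {s & M s}.

(* Terms and formulas are indexed by their context of free variables: the
   elements of V, of sorts vs.  A quantifier extends the context by one
   variable, which is None : option V.  Parameters (constants naming elements)
   are treated as free variables with a prescribed value. *)
Definition ctx_ext (S V : Type) (vs : V -> S) (t : S) (o : option V) : S :=
  if o is Some x then vs x else t.

Definition env_ext (S : Type) (M : S -> Type) (V : Type) (vs : V -> S) (t : S)
    (e : forall x, M (vs x)) (c : M t) (o : option V) : M (ctx_ext vs t o) :=
  match o return M (ctx_ext vs t o) with Some x => e x | None => c end.

Inductive term (L : language) (V : Type) (vs : V -> sorts L) :
    sorts L -> Type :=
| Var (x : V) : term vs (vs x)
| App (f : funs L) (args : forall i, term vs (fdom (f := f) i)) :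
    term vs (fcod f).

Inductive formula (L : language) (V : Type) (vs : V -> sorts L) : Type :=
| Falsum
| Equal (t : sorts L) (t1 t2 : term vs t)
| Rel (r : rels L) (args : forall i, term vs (rdom (r := r) i))
| Imp (phi psi : formula vs)
| All (t : sorts L) (phi : @formula L (option V) (ctx_ext vs t)).

Fixpoint eval (L : language) (M : structure L) (V : Type) (vs : V -> sorts L)
    (e : forall x, M (vs x)) (s : sorts L) (t : term vs s) : M s :=
  match t with
  | Var x => e x
  | App f args => fun_interp (fun i => eval e (args i))
  end.

Fixpoint sat (L : language) (M : structure L) (V : Type) (vs : V -> sorts L)
    (e : forall x, M (vs x)) (phi : formula vs) : Prop :=
  match phi with
  | Falsum => False
  | Equal t t1 t2 => eval e t1 = eval e t2
  | Rel r args => rel_interp (fun i => eval e (args i))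
  | Imp phi psi => sat e phi -> sat e psi
  | All t phi => forall c : M t, sat (env_ext e c) phi
  end.

Definition sentence (L : language) : Type := formula (of_void (sorts L)).

Definition holds (L : language) (M : structure L) (phi : sentence L) : Prop :=
  sat (fun x : void => of_void (M (of_void (sorts L) x)) x) phi.

Definition theory (L : language) : Type := set (sentence L).

Definition Th (L : language) (M : structure L) : theory L :=
  [set phi | holds M phi].

Definition models (L : language) (M : structure L) (T : theory L) : Prop :=
  T `<=` Th M.

Record iso (L : language) (M N : structure L) := Iso {
  iso_fun :> forall s, M s -> N s;
  iso_bij : forall s, bijective (@iso_fun s);
  iso_fun_interp : forall (f : funs L) a,
    iso_fun (fun_interp (f := f) a) =
    fun_interp (f := f) (fun i => iso_fun (a i));
  iso_rel_interp : forall (r : rels L) a,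
    rel_interp (r := r) a <->
    rel_interp (r := r) (fun i => iso_fun (a i)) }.

Definition aut (L : language) (M : structure L) : Type := iso M M.

Local Obligation Tactic := idtac.

Section AutGroup.
Variables (L : language) (M : structure L).
Implicit Types g h : aut M.

Lemma aut_ext g h : (forall s (a : M s), g s a = h s a) -> g = h.
Proof.
case: g h => [g gb gf gr] [h hb hf hr] /= gh.
have E : g = h.
  by apply: functional_extensionality_dep => s; apply/funext => a; exact: gh.
by subst h; congr Iso; exact: Prop_irrelevance.
Qed.

Program Definition aut_one : aut M := @Iso L M M (fun s a => a) _ _ _.
Next Obligation. by move=> s; exists (fun a => a). Qed.
Next Obligation. by []. Qed.
Next Obligation. by []. Qed.

Program Definition aut_mul g h : aut M :=
  @Iso L M M (fun s a => g s (h s a)) _ _ _.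
Next Obligation.
by move=> g h s; exact: (bij_comp (iso_bij g s) (iso_bij h s)).
Qed.
Next Obligation. by move=> g h f a /=; rewrite !iso_fun_interp. Qed.
Next Obligation.
by move=> g h r a /=; rewrite (iso_rel_interp h) (iso_rel_interp g).
Qed.

Lemma aut_inv_ex g : exists k : forall s, M s -> M s,
  forall s, cancel (g s) (k s) /\ cancel (k s) (g s).
Proof.
have H s : {k | cancel (g s) k /\ cancel k (g s)}.
  by apply: cid; case: (iso_bij g s) => k gk kg; exists k.
by exists (fun s => sval (H s)) => s; exact: (svalP (H s)).
Qed.

Definition aut_inv_fun g : forall s, M s -> M s := sval (cid (aut_inv_ex g)).

Lemma aut_invK g s : cancel (g s) (@aut_inv_fun g s).
Proof. exact: (svalP (cid (aut_inv_ex g)) s).1. Qed.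

Lemma aut_invKV g s : cancel (@aut_inv_fun g s) (g s).
Proof. exact: (svalP (cid (aut_inv_ex g)) s).2. Qed.

Program Definition aut_inv g : aut M := @Iso L M M (aut_inv_fun g) _ _ _.
Next Obligation.
by move=> g s; exists (g s); [exact: aut_invKV|exact: aut_invK].
Qed.
Next Obligation.
move=> g f a /=; apply: (can_inj (@aut_invK g _)).
rewrite aut_invKV iso_fun_interp.
congr fun_interp; apply: functional_extensionality_dep => i.
by rewrite aut_invKV.
Qed.
Next Obligation.
move=> g r a /=; rewrite [X in _ <-> X](iso_rel_interp g).
have -> // : (fun i => g _ (aut_inv_fun g (a i))) = a.
by apply: functional_extensionality_dep => i; rewrite aut_invKV.
Qed.

HB.instance Definition _ := gen_eqMixin (aut M).
HB.instance Definition _ := gen_choiceMixin (aut M).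

Lemma aut_mulA : associative aut_mul.
Proof. by move=> f g h; apply: aut_ext. Qed.
Lemma aut_mul1g : left_id aut_one aut_mul.
Proof. by move=> g; apply: aut_ext. Qed.
Lemma aut_mulg1 : right_id aut_one aut_mul.
Proof. by move=> g; apply: aut_ext. Qed.
Lemma aut_mulVg : left_inverse aut_one aut_inv aut_mul.
Proof. by move=> g; apply: aut_ext => s a /=; rewrite aut_invK. Qed.
Lemma aut_mulgV : right_inverse aut_one aut_inv aut_mul.
Proof. by move=> g; apply: aut_ext => s a /=; rewrite aut_invKV. Qed.

HB.instance Definition _ := isGroup.Build (aut M)
  aut_mulA aut_mul1g aut_mulg1 aut_mulVg aut_mulgV.

Definition aut_graph g :
    prod_topology (fun x : elements M =>
      discrete_topology {classic M (projT1 x)}) :=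
  fun x => g (projT1 x) (projT2 x).

(* Pointwise convergence, M being discrete. *)
HB.instance Definition _ :=
  Topological.copy (aut M) (initial_topology aut_graph).

End AutGroup.

#[short(type="preTopologicalGroupType")]
HB.structure Definition PreTopologicalGroup :=
  { G of Topological G & Group G }.

HB.mixin Record PreTopologicalGroup_isTopologicalGroup G
    of PreTopologicalGroup G := {
  mulg_continuous : continuous (fun p : G * G => (p.1 * p.2)%g);
  invg_continuous : continuous (fun x : G => (x^-1)%g) }.

#[short(type="topologicalGroupType")]
HB.structure Definition TopologicalGroup :=
  { G of PreTopologicalGroup G & PreTopologicalGroup_isTopologicalGroup G }.

Section AutTopology.

Lemma cvg_initialP (S : choiceType) (T : topologicalType) (f : S -> T)
    (F : set_system S) (x : S) : Filter F ->
  F --> (x : initial_topology f) <-> f @ F --> f x.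
Proof.
move=> FF; split=> [Fx U Ux|H U].
  by apply: Fx; exact: (@initial_continuous _ _ f x U Ux).
rewrite nbhsE => -[_ [[B oB <-] Bx] BU].
by apply: (filterS BU); apply: (H B); exact: open_nbhs_nbhs.
Qed.

Variables (L : language) (M : structure L).

Lemma cvg_autP (F : set_system (aut M)) (g : aut M) : Filter F ->
  F --> g <-> forall s (a : M s), F [set h | h s a = g s a].
Proof.
move=> FF; split.
  move=> /(cvg_initialP (@aut_graph L M) g FF)/cvg_sup H s a.
  have := H (existT _ s a).
  move=> /(cvg_initialP _ _ (fmap_filter _ _)) /= K.
  by apply: (K [set b | b = g s a]); exact/principal_filterP.
move=> H; apply/(cvg_initialP (@aut_graph L M) g FF)/cvg_sup => -[s a].
apply/(cvg_initialP _ _ (fmap_filter _ _)) => U /principal_filterP Ug.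
apply: (@filterS _ F _ _ _ _ (H s a)) => h /= hg.
by rewrite /aut_graph /= hg.
Qed.

Lemma nbhs_aut (g : aut M) s (a : M s) : nbhs g [set h | h s a = g s a].
Proof. exact: (cvg_autP g (nbhs_filter g)).1 cvg_id s a. Qed.

Lemma aut_mul_continuous :
  continuous (fun p : aut M * aut M => (p.1 * p.2)%g).
Proof.
move=> [g h]; apply/(cvg_autP _ (fmap_filter _ (nbhs_filter (g, h)))) => s a.
exists ([set g' : aut M | g' s (h s a) = g s (h s a)],
        [set h' : aut M | h' s a = h s a]).
  by split; exact: nbhs_aut.
by move=> [g' h'] [/= Eg Eh]; rewrite /= Eh.
Qed.

Lemma aut_inv_continuous : continuous (fun g : aut M => (g^-1)%g).
Proof.
move=> g; apply/(cvg_autP _ (fmap_filter _ (nbhs_filter g))) => s a.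
have Hg := @nbhs_aut g s (aut_inv g s a).
apply: (@filterS _ _ (nbhs_filter g) _ _ _ Hg) => h /= hg.
by apply: (can_inj (@aut_invK L M h s)); rewrite hg !aut_invKV.
Qed.

HB.instance Definition _ := PreTopologicalGroup_isTopologicalGroup.Build
  (aut M) aut_mul_continuous aut_inv_continuous.

End AutTopology.

Definition continuous_action (G : topologicalGroupType) (X : topologicalType)
    (act : G -> X -> X) : Prop :=
  [/\ forall x, act 1%g x = x,
      forall g h x, act (g * h)%g x = act g (act h x)
    & continuous (fun p : G * X => act p.1 p.2)].

Definition extremely_amenable (G : topologicalGroupType) : Prop :=
  forall (X : topologicalType) (act : G -> X -> X),
    [set: X] !=set0 -> compact [set: X] -> hausdorff_space X ->
    continuous_action act ->
  exists x, forall g, act g x = x.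

Definition countable_language (L : language) : Prop :=
  [/\ countable [set: sorts L], countable [set: funs L]
    & countable [set: rels L]].

Definition countable_structure (L : language) (M : structure L) : Prop :=
  countable [set: elements M].

(* Countable means finite or countably infinite here, so that a theory whose
   only model up to isomorphism is finite counts as omega-categorical. *)
Definition omega_categorical (L : language) (T : theory L) : Prop :=
  exists M : structure L, [/\ countable_structure M, models M T
    & forall N : structure L, countable_structure N -> models N T ->
        inhabited (iso M N)].

Definition card_lt (T U : Type) (A : set T) (B : set U) : bool :=
  (A #<= B) && ~~ (B #<= A).

Reserved Notation "A '#<' B" (at level 79, format "A  '#<'  B").
Notation "A '#<' B" := (card_lt A B) : card_scope.

(* Cardinals are represented by types: kappa is the cardinality of K. *)
Definition strong_limit (K : Type) : Prop :=
  [set: nat] #< [set: K] /\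
  forall A : set K, A #< [set: K] -> [set B | B `<=` A] #< [set: K].

(* A set of fewer than kappa parameters is listed as a family a indexed by I;
   p is a set of formulas in one free variable of sort t over it. *)
Definition saturated (K : Type) (L : language) (C : structure L) : Prop :=
  forall (I : Type) (s : I -> sorts L) (a : forall i, C (s i)) (t : sorts L)
    (p : set (formula (ctx_ext s t))),
    [set: I] #< [set: K] ->
    (forall q, finite_set q -> q `<=` p ->
      exists c : C t, forall phi, q phi -> sat (env_ext a c) phi) ->
  exists c : C t, forall phi, p phi -> sat (env_ext a c) phi.

Definition same_type (L : language) (C : structure L) (I : Type)
    (s : I -> sorts L) (a b : forall i, C (s i)) : Prop :=
  forall phi : formula s, sat a phi <-> sat b phi.

Definition strongly_homogeneous (K : Type) (L : language) (C : structure L) :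
    Prop :=
  forall (I : Type) (s : I -> sorts L) (a b : forall i, C (s i)),
    [set: I] #< [set: K] -> same_type a b ->
  exists g : aut C, forall i, g (s i) (a i) = b i.

(* The strong limit cardinal kappa is large as soon as it exceeds the number of
   formulas, i.e. the number of symbols of the language. *)
Definition monster (K : Type) (L : language) (C : structure L) : Prop :=
  [/\ strong_limit K,
      [/\ [set: sorts L] #< [set: K], [set: funs L] #< [set: K]
        & [set: rels L] #< [set: K]],
      saturated K C
    & strongly_homogeneous K C].

Section Lascar.
Variables (K : Type) (L : language) (C : structure L).

Section ProductOfSorts.
Variables (I : Type) (s : I -> sorts L).
Implicit Types (a b : forall i, C (s i)).
Implicit Types (E : (forall i, C (s i)) -> (forall i, C (s i)) -> Prop).

Definition bounded E : Prop :=
  [set X | exists a, X = [set b | E a b]] #< [set: K].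

Definition aut_invariant E : Prop :=
  forall (g : aut C) a b,
    E a b <-> E (fun i => g (s i) (a i)) (fun i => g (s i) (b i)).

(* The finest bounded invariant equivalence relation, as the intersection of all
   of them (in a monster model this intersection is itself bounded). *)
Definition E_L a b : Prop :=
  forall E, Equivalence E -> aut_invariant E -> bounded E -> E a b.

End ProductOfSorts.

Definition Autf_L : set (aut C) :=
  [set g | forall (I : Type) (s : I -> sorts L) (a : forall i, C (s i)),
     [set: I] #< [set: K] -> E_L a (fun i => g (s i) (a i))].

Definition Autf_L_coset (g : aut C) : set (aut C) :=
  [set h | Autf_L (g^-1 * h)%g].

(* Aut(C) / Autf_L(C), as a set of cosets. *)
Definition Gal_L : set (set (aut C)) := range Autf_L_coset.

End Lascar.

Arguments Autf_L K {L} C _.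
Arguments Gal_L K {L} C _.

(* The group Gal_L does not depend on the monster model, so quantifying over all
   monster models is a choice of convention only. *)
Definition Gal_L_trivial (L : language) (T : theory L) : Prop :=
  forall (K : Type) (C : structure L),
    monster K C -> models C T -> Gal_L K C = [set Autf_L_coset K 1%g].

Definition add_constants (L : language) (X : Type) (cs : X -> sorts L) :
    language :=
  @Language (sorts L) (funs L + X)%type (rels L)
    (fun f => if f is inl f then farity f else 0)
    (fun f => match f return 'I_(if f is inl f then farity f else 0) -> sorts L
              with inl f => @fdom L f | inr x => fun=> cs x end)
    (fun f => match f with inl f => fcod f | inr x => cs x end)
    (@rarity L) (@rdom L).

Definition expand (L : language) (M : structure L) (X : Type)
    (cs : X -> sorts L) (c : forall x, M (cs x)) :
    structure (add_constants cs) :=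
  @Structure (add_constants cs) M
    (fun f => match f return (forall i, M (@fdom (add_constants cs) f i)) ->
                             M (@fcod (add_constants cs) f)
              with
              | inl f => @fun_interp L M f
              | inr x => fun=> c x
              end)
    (@rel_interp L M).

Definition expand_set (L : language) (C : structure L) (A : set (elements C)) :=
  expand (fun x : A => projT2 (\val x)).

Definition G_trivial (L : language) (T : theory L) : Prop :=
  forall (K : Type) (C : structure L), monster K C -> models C T ->
  forall A : set (elements C), finite_set A -> Gal_L_trivial (Th (expand_set A)).

(* Main.v *)
From mathcomp Require Import all_boot.
From mathcomp Require Import all_classical wochoice.
From mathcomp Require Import topology_structure compact separation_axioms
  initial_topology bool_topology product_topology
  function_spaces supremum_topology subtype_topology.
Require Import Defs.

Set Implicit Arguments.
Unset Strict Implicit.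
Unset Printing Implicit Defensive.

Local Open Scope classical_set_scope.
Local Open Scope card_scope.

(** The theorem says that, in a monster model C of the theory of M with finitely
    many constants added, every automorphism g fixes all E_L-classes.  So let a
    be a small tuple of C, b = g a, and E a bounded invariant equivalence
    relation; the claim is E a b.

    It is enough to find tuples c_w indexed by a linear order W, where W has
    more elements than E has classes, such that
      (c_w, c_w'), (a, c_w') and (b, c_w') have the same type for all w < w'.
    By the pigeonhole principle E c_w c_w' for some w < w'.  Strong homogeneity
    turns equality of types into conjugacy, and E is invariant, so E a c_w' and
    E b c_w', hence E a b [pattern_E_L].  (If tp(a) has a global invariant
    extension q, a Morley sequence of q over a, b is such an array.)

    By saturation in many variables [saturated_family], such an array exists as
    soon as it exists for sequences of length omega and finitely many formulas
    [pattern_realized].  These formulas involve only finitely many coordinates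
    of a and b.  Put these coordinates in a countable elementary submodel N of C
    that is closed under g and its inverse [lowenheim_skolem].  The reduct of N
    to the language of M is a countable model of Th(M), hence isomorphic to M,
    and its automorphism group G is extremely amenable.  The restriction of g to
    N lies in the stabilizer H of the constants, so b lies in the H-orbit of a.

    Extreme amenability now enters [invariant_truth_value].  Consider the
    functions that guess, for each formula phi and each p in the orbit, whether
    phi(p, c) holds for a generic c in the orbit.  The finitely realizable
    guesses form a compact space.  A guess fixed by H gives phi(p, c) the same
    truth value v(phi) for all p in the orbit.  Any finite part of the guess is
    realized by an actual c, so a sequence c_0, c_1, ... with
      phi(c_k, c_l) = phi(a, c_l) = phi(b, c_l) = v(phi)   for k < l
    can be built term by term [finite_pattern].

    Only G, and not its open subgroup H, is known to be extremely amenable.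
    Therefore the flow is built over all G-conjugates of the constants at once,
    that is, as the flow coinduced from H to G. *)

(** * Actions of extremely amenable groups on colorings *)

Lemma finite_set_ind (T : Type) (P : set T -> Prop) :
  P set0 -> (forall x S, finite_set S -> P S -> P (x |` S)) ->
  forall S, finite_set S -> P S.
Proof.
elim/Peq: T => T in P *; move=> P0 PU S /finite_seqP[s ->].
elim: s => [|x s IH].
  by rewrite (_ : [set` _] = set0) //; apply/seteqP; split.
rewrite (_ : [set` _] = x |` [set` s]); last first.
  by apply/seteqP; split=> y /=; rewrite inE => /predU1P.
by apply: PU; first exact: finite_seq.
Qed.

Lemma filter_forall_finite (T I : Type) (F : set_system T) (S : set I)
    (A : I -> set T) : Filter F -> finite_set S ->
  (forall i, S i -> F (A i)) -> F [set t | forall i, S i -> A i t].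
Proof.
move=> FF Sfin; elim/finite_set_ind: S / Sfin => [_|i S _ IH FA].
  by apply: filterS filterT => t _ i [].
have Fi : F (A i) by apply: FA; left.
have {}IH : F [set t | forall i, S i -> A i t].
  by apply: IH => j Sj; apply: FA; right.
by apply: filterS (filterI Fi IH) => t [Ait St] j [->|/St].
Qed.

(** Two-colorings of a G-set D with open stabilizers form a compact G-space
    under translation, because g^-1 d is locally constant in g.  The last
    hypothesis says that Y is closed for pointwise convergence, so Y is a
    subflow; it is stated without topology because this is how it is
    verified. *)
Lemma fixed_coloring (G : topologicalGroupType) (D : Type) (act : G -> D -> D)
    (Y : set (D -> bool)) :
  extremely_amenable G ->
  (forall d, act 1%g d = d) ->
  (forall g h d, act (g * h)%g d = act g (act h d)) ->
  (forall d, nbhs (1%g : G) [set g | act g d = d]) ->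
  Y !=set0 ->
  (forall g f, Y f -> Y (f \o act g)) ->
  (forall f, (forall S, finite_set S ->
     exists2 f', Y f' & forall d, S d -> f' d = f d) -> Y f) ->
  exists2 f, Y f & forall g d, f (act g d) = f d.
Proof.
elim/Peq: D => D in act Y *; move=> EA act1 actM stab Y0 Yact Yfin.
pose Z := prod_topology (fun _ : D => bool).
pose YZ : set Z := Y.
have coord (f : Z) d : nbhs f [set f' : Z | f' d = f d].
  have := @proj_continuous D (fun=> bool) d f [set b | b = f d].
  by apply; exact/principal_filterP.
have Yclosed : closed YZ.
  move=> f clf; apply: Yfin => S Sfin.
  have /clf[f' [Yf' f'S]] : nbhs f [set f' : Z | forall d, S d -> f' d = f d].
    by apply: filter_forall_finite => // d _; exact: coord.
  by exists f'.
have Zcompact : compact [set: Z].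
  have := @tychonoff D (fun=> bool) (fun=> setT) (fun=> bool_compact).
  by congr compact; apply/seteqP; split.
have Ycompact := subclosed_compact Yclosed Zcompact (@subsetT _ _).
have actV g : cancel (act g) (act g^-1%g) by move=> d; rewrite -actM mulVg.
pose X : topologicalType := YZ : Type.
pose flow (g : G) (f : X) : X := SigSub (mem_set (Yact g^-1%g _ (set_valP f))).
have Xcompact : compact [set: X].
  move=> F FF _; have Fv := fmap_proper_filter (set_val : X -> Z) FF.
  have [|f [Yf clf]] := Ycompact _ Fv.
    by apply: (@filterS _ F _ setT) => [f _|]; [exact: set_valP|exact: filterT].
  exists (SigSub (mem_set Yf)); split=> // A B FA [B' [[O oO <-] /= Of] OB].
  have [h [[h' Ah' <-] Oh]] : (set_val @` A) `&` O !=set0.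
    apply: clf; last by apply: open_nbhs_nbhs.
    by apply: (@filterS _ F _ A) FA => h Ah; exists h.
  by exists h'; split=> //; apply: OB.
have Xhausdorff : hausdorff_space X.
  have hZ : hausdorff_space Z.
    by apply: hausdorff_product => d; exact: discrete_hausdorff.
  move=> f h clfh; apply: val_inj; apply: hZ => A B nA nB.
  have [k [Ak Bk]] := clfh (set_val @^-1` A) (set_val @^-1` B)
    (@initial_continuous _ _ (set_val : YZ -> Z) f A nA)
    (@initial_continuous _ _ (set_val : YZ -> Z) h B nB).
  by exists (set_val k).
have [||f fix_f] := EA X flow _ Xcompact Xhausdorff.
- by case: Y0 => f Yf; exists (SigSub (mem_set Yf)).
- split.
  + by move=> f; apply: val_inj; apply/funext => d /=; rewrite invg1 act1.
  + by move=> g h f; apply: val_inj; apply/funext => d /=; rewrite invgM actM.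
  + move=> [g f]; apply/cvg_initialP/cvg_sup => d.
    apply/cvg_initialP => U /principal_filterP Ud.
    pose d' := act g^-1%g d.
    (* The stabilizer of d' is open, and h^-1 g tends to 1 as h tends to g. *)
    have near_g : nbhs g [set h : G | act h^-1%g d = d'].
      have divg : (fun h : G => h^-1 * g)%g @ g --> (1%g : G).
        rewrite -(mulVg g).
        apply: (@continuous_comp _ _ _ (fun h : G => (h^-1, g)%g)
          (fun p : G * G => (p.1 * p.2)%g)); last exact: mulg_continuous.
        by apply: cvg_pair; [exact: invg_continuous|exact: cvg_cst].
      have := divg _ (stab d').
      apply: (@filterS _ (nbhs g) _) => h /=.
      by rewrite -actM -mulgA mulgV mulg1.
    have near_f : nbhs f [set h : X | set_val h d' = set_val f d'].
      exact: (@initial_continuous _ _ (set_val : YZ -> Z) f _ (coord _ d')).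
    exists ([set h : G | act h^-1%g d = d'],
            [set h : X | set_val h d' = set_val f d']) => //.
    move=> [h k] /= [hd kd].
    by rewrite [X in U X](_ : _ = set_val k (act h^-1%g d)) // hd kd.
exists (set_val f); first exact: set_valP.
move=> g d; have := congr1 (fun k : X => set_val k (act g d)) (fix_f g).
by rewrite [LHS](_ : _ = set_val f (act g^-1%g (act g d))) // actV.
Qed.

(** A relation R j on P that is invariant under the stabilizer H of k0 admits a
    truth value v j such that, on any finite set of p in the H-orbit of a, some
    c in this orbit makes all R j p c equal to v j.

    For H = G this is a fixed point in the closure of the colorings
    (p, j) |-> R j p c.  The general case is coinduced from H: a coloring f of
    K * P * J contains, for each conjugate k = g k0, a coloring f (k, _) of the
    kind required by the g-conjugate of R.  A coloring fixed by G restricts at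
    k0 to one that is fixed by H, hence constant in p on the orbit. *)
Lemma invariant_truth_value (G : topologicalGroupType) (K P J : Type)
    (actK : G -> K -> K) (actP : G -> P -> P) (k0 : K) (a : P)
    (R : J -> P -> P -> Prop) :
  extremely_amenable G ->
  (forall k, actK 1%g k = k) ->
  (forall g h k, actK (g * h)%g k = actK g (actK h k)) ->
  (forall k, nbhs (1%g : G) [set g | actK g k = k]) ->
  (forall p, actP 1%g p = p) ->
  (forall g h p, actP (g * h)%g p = actP g (actP h p)) ->
  (forall p, nbhs (1%g : G) [set g | actP g p = p]) ->
  (forall h j p q, actK h k0 = k0 -> R j p q -> R j (actP h p) (actP h q)) ->
  let orbit := [set actP h a | h in [set h | actK h k0 = k0]] in
  exists v : J -> Prop, forall S, finite_set S ->
    (forall j p, S (j, p) -> orbit p) ->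
  exists2 c, orbit c & forall j p, S (j, p) -> R j p c <-> v j.
Proof.
move=> EA K1 KM Ks P1 PM Ps Rinv orbit.
have stabV h : actK h k0 = k0 -> actK h^-1%g k0 = k0.
  by move=> {1}<-; rewrite -KM mulVg K1.
have RinvE h j p q : actK h k0 = k0 -> R j (actP h p) (actP h q) <-> R j p q.
  move=> hk; split; last exact: Rinv.
  by move=> /(Rinv _ _ _ _ (stabV h hk)); rewrite -!PM mulVg !P1.
pose act g (d : K * P * J) := (actK g d.1.1, actP g d.1.2, d.2).
pose Y (f : K * P * J -> bool) := forall g S, finite_set S ->
  exists2 c, orbit c &
    forall j p, S (j, p) -> f (actK g k0, actP g p, j) <-> R j p c.
have [| | | | | |f Yf f_inv] := @fixed_coloring G _ act Y EA.
- by move=> [[k p] j]; rewrite /act /= K1 P1.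
- by move=> g h [[k p] j]; rewrite /act /= KM PM.
- move=> [[k p] j].
  have := @filterI _ _ (nbhs_filter (1%g : G)) _ _ (Ks k) (Ps p).
  apply: (@filterS _ _ (nbhs_filter (1%g : G))) => g [/= gk gp].
  by rewrite /act /= gk gp.
(* Choose for each conjugate k of k0 some s k that carries k0 to k, and
   transport the coloring R j p a of the fibre over k0 to the fibre over k. *)
- have [s s_k] : exists s : K -> G,
      forall g, actK (s (actK g k0)) k0 = actK g k0.
    have /choice[s sP] : forall k, exists h : G,
        (exists g, actK g k0 = k) -> actK h k0 = k.
      move=> k; have [[g gk]|n] := pselect (exists g, actK g k0 = k).
        by exists g.
      by exists 1%g.
    by exists s => g; apply: sP; exists g.
  exists (fun d => `[< R d.2 (actP (s d.1.1)^-1%g d.1.2) a >]) => g S _.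
  pose h := (g^-1 * s (actK g k0))%g.
  have hk : actK h k0 = k0 by rewrite KM s_k -KM mulVg K1.
  exists (actP h a); first by exists h.
  move=> j p _ /=.
  have -> : actP (s (actK g k0))^-1%g (actP g p) = actP h^-1%g p.
    by rewrite -PM /h invgM invgK.
  rewrite -[in X in _ <-> X](RinvE h^-1%g) ?stabV // -!PM mulVg P1.
  by split=> /asboolP.
- move=> g f Yf h S Sfin; have [c oc cP] := Yf (g * h)%g S Sfin.
  by exists c => // j p /cP; rewrite KM PM.
- move=> f Hf g S Sfin.
  have [|f' Yf' ff'] := Hf [set (actK g k0, actP g jp.2, jp.1) | jp in S].
    exact: finite_image.
  have [c oc cP] := Yf' g S Sfin; exists c => // j p Sjp.
  by rewrite -ff'; [exact: cP|exists (j, p)].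
exists (fun j => f (k0, a, j)) => S Sfin So.
have [c oc cP] := Yf 1%g S Sfin; exists c => // j p Sjp.
rewrite -(cP _ _ Sjp) K1 P1; have [h hk <-] := So _ _ Sjp.
by rewrite -(f_inv h (k0, a, j)) /act /= hk.
Qed.

(** * Cardinals below a strong limit *)

Definition small (K T : Type) : Prop := [set: T] #< [set: K].

Lemma card_le_setTP (T U : Type) :
  [set: T] #<= [set: U] <-> exists f : T -> U, injective f.
Proof.
split=> [/card_leP[f]|[f fI]].
  pose e (t : T) : [set: T] := SigSub (mem_set (Logic.I : [set: T] t)).
  exists (fun t => val (f (e t))) => x y /val_inj /inj.
  by rewrite !inE => /(_ Logic.I Logic.I) /(congr1 val).
have fT : f @` [set: T] #= [set: T] by apply: inj_card_eq => x y _ _; exact: fI.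
by rewrite -(card_le_eql fT); exact: subset_card_le.
Qed.

Lemma no_inj_powerset (T : Type) (f : set T -> T) : ~ injective f.
Proof.
move=> fI; pose D := [set t | exists2 A, f A = t & ~ A t].
have : D (f D) <-> ~ D (f D).
  split=> [[A /fI -> //]|nD]; by exists D.
tauto.
Qed.

(** A maximal injective partial function has full domain or full range. *)
Lemma inj_or_inj (T U : Type) :
  (exists f : T -> U, injective f) \/ (exists f : U -> T, injective f).
Proof.
pose P (A : set (T * U)) := forall p q, A p -> A q -> p.1 = q.1 <-> p.2 = q.2.
have [F FP totF|A [PA Amax]] := @Zorn_bigcup _ P.
  move=> p q [B FB Bp] [C FC Cq].
  have [BC|CB] := totF _ _ FB FC; first exact: (FP _ FC _ _ (BC _ Bp) Cq).
  exact: (FP _ FB _ _ Bp (CB _ Cq)).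
have [totl|/existsNP[t nt]] := pselect (forall t, exists u, A (t, u)).
  have [f fA] := choice totl; left; exists f => x y fxy.
  exact: (PA (x, f x) (y, f y) _ _).2.
have [totr|/existsNP[u nu]] := pselect (forall u, exists t, A (t, u)).
  have [f fA] := choice totr; right; exists f => x y fxy.
  exact: (PA (f x, x) (f y, y) _ _).1.
exfalso; apply: (Amax ((t, u) |` A)).
  split=> [x Ax|/(_ (t, u) (or_introl erefl)) Atu]; first by right.
  by apply: nt; exists u.
move=> [t1 u1] [t2 u2] [[-> ->]|A1] [[-> ->]|A2] //=.
- by split=> E; subst; exfalso; [apply: nt|apply: nu]; eexists; exact: A2.
- by split=> E; subst; exfalso; [apply: nt|apply: nu]; eexists; exact: A1.
- exact: (PA _ _ A1 A2).
Qed.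

Section Small.
Variable K : Type.
Hypothesis Klim : strong_limit K.

Lemma small_inj_into (T U : Type) (A : set U) (f : T -> U) :
  injective f -> range f `<=` A -> A #< [set: K] -> small K T.
Proof.
move=> fI fA /andP[AK KA].
have fT : range f #= [set: T] by apply: inj_card_eq => x y _ _; exact: fI.
have TA : [set: T] #<= A by rewrite -(card_le_eql fT); exact: subset_card_le.
apply/andP; split; first exact: card_le_trans AK.
by apply: contra KA => KT; exact: card_le_trans TA.
Qed.

Lemma small_inj (T U : Type) (f : T -> U) :
  injective f -> small K U -> small K T.
Proof. by move=> fI; apply: (small_inj_into fI); exact: subsetT. Qed.

Lemma small_set (T : Type) : small K T -> small K (set T).
Proof.
move=> Tsm; have /andP[/card_le_setTP[f fI] _] := Tsm.
have fT : range f #< [set: K].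
  have E : range f #= [set: T] by apply: inj_card_eq => x y _ _; exact: fI.
  by rewrite /card_lt (card_le_eql E) (card_le_eqr E).
apply: (@small_inj_into _ _ _ (fun B : set T => f @` B) _ _ (Klim.2 _ fT)).
  move=> B C BC; apply/seteqP; split=> x.
    move=> Bx; have : (f @` B) (f x) by exists x.
    by rewrite BC => -[y Cy /fI <-].
  move=> Cx; have : (f @` C) (f x) by exists x.
  by rewrite -BC => -[y By /fI <-].
by move=> _ [B _ <-]; exact: image_subset.
Qed.

Lemma small_bool : small K bool.
Proof.
apply: (@small_inj bool nat nat_of_bool); last exact: Klim.1.
by move=> [] [].
Qed.

(** Comparability reduces this to a square, and Kuratowski pairs embed the
    square of Z into its double powerset. *)
Lemma small_prod (T U : Type) : small K T -> small K U -> small K (T * U).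
Proof.
have sq (Z : Type) : small K Z -> small K (Z * Z).
  move=> /small_set/small_set.
  apply: (@small_inj _ _ (fun p : Z * Z => [set [set p.1]; [set p.1; p.2]])).
  move=> [x y] [x' y'] /= E.
  have Ex A : A = [set x] \/ A = [set x; y] <->
      A = [set x'] \/ A = [set x'; y'].
    by have := congr1 (fun F => F A) E; rewrite /= => ->.
  have xx : x' = x.
    by have [/(_ (or_introl erefl))[] e _] := Ex [set x];
      have : [set x] x' by [rewrite e; left | rewrite e].
  subst x'; congr pair.
  have y1 : y = x \/ y = y'.
    have [/(_ (or_intror erefl))[] e _] := Ex [set x; y];
      have : [set x; y] y by [right].
      by rewrite e; left.
    by rewrite e.
  have y2 : y' = x \/ y' = y.
    have [_ /(_ (or_intror erefl))[] e] := Ex [set x; y'];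
      have : [set x; y'] y' by [right].
      by rewrite e; left.
    by rewrite e.
  by case: y1 y2 => [->|->] // [->|->].
move=> Ts Us; have [[f fI]|[f fI]] := inj_or_inj T U.
  apply: (@small_inj _ _ (fun p : T * U => (f p.1, p.2))) (sq _ Us).
  by move=> [x y] [x' y'] [/fI-> ->].
apply: (@small_inj _ _ (fun p : T * U => (p.1, f p.2))) (sq _ Ts).
by move=> [x y] [x' y'] [-> /fI->].
Qed.

Lemma small_sum (T U : Type) : small K T -> small K U -> small K (T + U).
Proof.
move=> Ts Us; have [[f fI]|[f fI]] := inj_or_inj T U.
  apply: (@small_inj _ _ (fun s : T + U =>
    match s with inl t => (f t, true) | inr u => (u, false) end))
    (small_prod Us small_bool).
  by move=> [x|x] [y|y] [] //; [move=> /fI -> | move=> ->].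
apply: (@small_inj _ _ (fun s : T + U =>
  match s with inl t => (t, true) | inr u => (f u, false) end))
  (small_prod Ts small_bool).
by move=> [x|x] [y|y] [] //; [move=> -> | move=> /fI ->].
Qed.

End Small.

(** * Variables and substitution in formulas *)

Section Syntax.
Variable L : language.

Definition ctx_ext_set (V : Type) (B : set V) : set (option V) :=
  [set o | if o is Some x then B x else True].

Fixpoint term_over (V : Type) (vs : V -> sorts L) (B : set V) (s : sorts L)
    (t : term vs s) : Prop :=
  match t with
  | Var x => B x
  | App f args => forall i, term_over B (args i)
  end.

(** A context V may be uncountable, for instance the set of all elements of a
    structure or a small set of variables.  Membership of the variables of a
    formula in a subset of V is the tool that brings back finiteness. *)
Fixpoint over (V : Type) (vs : V -> sorts L) (B : set V) (phi : formula vs) :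
    Prop :=
  match phi with
  | Falsum => True
  | Equal _ t1 t2 => term_over B t1 /\ term_over B t2
  | Rel r args => forall i, term_over B (args i)
  | Imp phi psi => over B phi /\ over B psi
  | All _ phi => over (ctx_ext_set B) phi
  end.

Lemma term_overS (V : Type) (vs : V -> sorts L) (A B : set V) s
    (t : term vs s) :
  A `<=` B -> term_over A t -> term_over B t.
Proof.
move=> AB; elim: t => [x|f args IH] /=; first exact: AB.
by move=> Aargs i; exact: IH.
Qed.

Lemma overS (V : Type) (vs : V -> sorts L) (A B : set V) (phi : formula vs) :
  A `<=` B -> over A phi -> over B phi.
Proof.
elim: phi A B => {V vs}
  [V vs|V vs s t1 t2|V vs r args|V vs phi IH psi IH2|V vs s phi IH] A B AB //=.
- by move=> [? ?]; split; exact: term_overS AB _.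
- by move=> H i; exact: term_overS AB _.
- by move=> [? ?]; split; [exact: IH AB _|exact: IH2 AB _].
- by apply: IH => -[x|] //=; exact: AB.
Qed.

Lemma term_over_setT (V : Type) (vs : V -> sorts L) s (t : term vs s) :
  term_over setT t.
Proof. by elim: t. Qed.

Lemma over_setT (V : Type) (vs : V -> sorts L) (phi : formula vs) :
  over setT phi.
Proof.
elim: phi => {V vs} //=.
- by move=> V vs s t1 t2; split; exact: term_over_setT.
- by move=> V vs r args i; exact: term_over_setT.
- by move=> V vs s phi; apply: overS => -[].
Qed.

Lemma term_over_finite (V : Type) (vs : V -> sorts L) (B : set V) s
    (t : term vs s) :
  term_over B t -> exists F, [/\ finite_set F, F `<=` B & term_over F t].
Proof.
elim: t => [x Bx|f args IH Bargs] /=.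
  by exists [set x]; split=> // _ ->.
have /choice[F FP] := fun i => IH i (Bargs i).
exists (\bigcup_i F i); split.
- by apply: bigcup_finite => [|i _]; [exact: finite_finset|case: (FP i)].
- by move=> x [i _ Fix]; case: (FP i) => _ + _; exact.
- by move=> i; case: (FP i) => _ _; apply: term_overS; exact: bigcup_sup.
Qed.

Lemma over_finite (V : Type) (vs : V -> sorts L) (B : set V)
    (phi : formula vs) :
  over B phi -> exists F, [/\ finite_set F, F `<=` B & over F phi].
Proof.
elim: phi B => {V vs}
  [V vs|V vs s t1 t2|V vs r args|V vs phi IH psi IH2|V vs s phi IH] B /=.
- by exists set0; split=> //; exact: finite_set0.
- move=> [/term_over_finite[F [Ff FB Ft]] /term_over_finite[F' [Ff' FB' Ft']]].
  exists (F `|` F'); split; first by rewrite finite_setU.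
    by move=> x [/FB|/FB'].
  by split; [apply: term_overS Ft => x; left
            |apply: term_overS Ft' => x; right].
- move=> Bargs; have /choice[F FP] := fun i => term_over_finite (Bargs i).
  exists (\bigcup_i F i); split.
  + by apply: bigcup_finite => [|i _]; [exact: finite_finset|case: (FP i)].
  + by move=> x [i _ Fix]; case: (FP i) => _ + _; exact.
  + by move=> i; case: (FP i) => _ _; apply: term_overS; exact: bigcup_sup.
- move=> [/IH[F [Ff FB Ft]] /IH2[F' [Ff' FB' Ft']]].
  exists (F `|` F'); split; first by rewrite finite_setU.
    by move=> x [/FB|/FB'].
  by split; [apply: overS Ft => x; left | apply: overS Ft' => x; right].
- move=> /IH[F [Ff FB Fphi]]; exists (Some @^-1` F); split.
  + by apply: finite_preimage => // x y _ _ [].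
  + by move=> x /FB.
  + by apply: overS Fphi => -[].
Qed.

Lemma eval_over (M : structure L) (V : Type) (vs : V -> sorts L) (B : set V) s
    (t : term vs s) (e e' : forall x, M (vs x)) :
  term_over B t -> (forall x, B x -> e x = e' x) -> eval e t = eval e' t.
Proof.
move=> Bt ee; elim: t Bt => [x|f args IH] /=; first exact: ee.
move=> Bargs; congr fun_interp; apply: functional_extensionality_dep => i.
exact: IH.
Qed.

Lemma sat_over (M : structure L) (V : Type) (vs : V -> sorts L) (B : set V)
    (phi : formula vs) (e e' : forall x, M (vs x)) :
  over B phi -> (forall x, B x -> e x = e' x) -> sat e phi <-> sat e' phi.
Proof.
elim: phi B e e' => {V vs}
  [V vs|V vs s t1 t2|V vs r args|V vs phi IH psi IH2|V vs s phi IH] B e e' //=.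
- by move=> [B1 B2] ee; rewrite !(eval_over _ ee).
- move=> Bargs ee.
  suff -> : (fun i => eval e (args i)) = (fun i => eval e' (args i)) by [].
  by apply: functional_extensionality_dep => i; exact: eval_over (Bargs i) ee.
- move=> [B1 B2] ee; have := IH _ _ _ B1 ee; have := IH2 _ _ _ B2 ee; tauto.
- move=> Bphi ee.
  have E c : sat (env_ext e c) phi <-> sat (env_ext e' c) phi.
    by apply: IH Bphi _ => -[x|] //= Bx; exact: ee.
  by split=> H c; apply/E.
Qed.

Fixpoint term_subst (V W : Type) (vs : V -> sorts L) (ws : W -> sorts L)
    (sigma : forall x, term ws (vs x)) (s : sorts L) (t : term vs s) :
    term ws s :=
  match t with
  | Var x => sigma x
  | App f args => App (fun i => term_subst sigma (args i))
  end.

Definition subst_ext (V W : Type) (vs : V -> sorts L) (ws : W -> sorts L)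
    (t : sorts L) (sigma : forall x, term ws (vs x)) (o : option V) :
    term (ctx_ext ws t) (ctx_ext vs t o) :=
  match o with
  | Some x => term_subst (fun y => Var (ctx_ext ws t) (Some y)) (sigma x)
  | None => Var (ctx_ext ws t) None
  end.

Fixpoint subst (V W : Type) (vs : V -> sorts L) (ws : W -> sorts L)
    (sigma : forall x, term ws (vs x)) (phi : formula vs) : formula ws :=
  match phi with
  | Falsum => Falsum ws
  | Equal _ t1 t2 => Equal (term_subst sigma t1) (term_subst sigma t2)
  | Rel r args => Rel (fun i => term_subst sigma (args i))
  | Imp phi psi => Imp (subst sigma phi) (subst sigma psi)
  | All t phi => All (subst (subst_ext t sigma) phi)
  end.

Lemma eval_term_subst (M : structure L) (V W : Type) (vs : V -> sorts L)
    (ws : W -> sorts L) (sigma : forall x, term ws (vs x)) s (t : term vs s)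
    (e : forall x, M (ws x)) :
  eval e (term_subst sigma t) = eval (fun x => eval e (sigma x)) t.
Proof.
elim: t => [//|f args IH] /=; congr fun_interp.
by apply: functional_extensionality_dep => i; exact: IH.
Qed.

Lemma sat_subst (M : structure L) (V W : Type) (vs : V -> sorts L)
    (ws : W -> sorts L) (sigma : forall x, term ws (vs x)) (phi : formula vs)
    (e : forall x, M (ws x)) :
  sat e (subst sigma phi) <-> sat (fun x => eval e (sigma x)) phi.
Proof.
elim: phi W ws sigma e => {V vs}
  [V vs|V vs s t1 t2|V vs r args|V vs phi IH psi IH2|V vs s phi IH]
  W ws sigma e //=.
- by rewrite !eval_term_subst.
- have -> // : (fun i => eval e (term_subst sigma (args i))) =
      (fun i => eval (fun x => eval e (sigma x)) (args i)).
  by apply: functional_extensionality_dep => i; rewrite eval_term_subst.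
- have := IH _ _ sigma e; have := IH2 _ _ sigma e; tauto.
- have E c : sat (env_ext e c) (subst (subst_ext s sigma) phi) <->
      sat (env_ext (fun x => eval e (sigma x)) c) phi.
    apply: (iff_trans (IH _ _ _ _)).
    set e1 := (X in sat X); set e2 := (X in _ <-> sat X _).
    suff -> : e1 = e2 by [].
    apply: functional_extensionality_dep => -[x|] //=.
    exact: eval_term_subst.
  by split=> H c; apply/E.
Qed.

Lemma term_over_subst (V W : Type) (vs : V -> sorts L) (ws : W -> sorts L)
    (sigma : forall x, term ws (vs x)) (A : set V) (B : set W) s
    (t : term vs s) :
  term_over A t -> (forall x, A x -> term_over B (sigma x)) ->
  term_over B (term_subst sigma t).
Proof.
move=> + AB; elim: t => [x|f args IH] /=; first exact: AB.
by move=> Aargs i; exact: IH.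
Qed.

Lemma over_subst (V W : Type) (vs : V -> sorts L) (ws : W -> sorts L)
    (sigma : forall x, term ws (vs x)) (A : set V) (B : set W)
    (phi : formula vs) :
  over A phi -> (forall x, A x -> term_over B (sigma x)) ->
  over B (subst sigma phi).
Proof.
elim: phi W ws sigma A B => {V vs}
  [V vs|V vs s t1 t2|V vs r args|V vs phi IH psi IH2|V vs s phi IH]
  W ws sigma A B //=.
- by move=> [A1 A2] AB; split;
    [exact: term_over_subst A1 AB|exact: term_over_subst A2 AB].
- by move=> Aargs AB i; exact: term_over_subst (Aargs i) AB.
- by move=> [A1 A2] AB; split; [exact: IH A1 AB|exact: IH2 A2 AB].
- move=> Aphi AB; apply: IH Aphi _ => -[x|] //= Ax.
  exact: term_over_subst (AB x Ax) _.
Qed.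

Lemma eval_iso (M N : structure L) (g : iso M N) (V : Type) (vs : V -> sorts L)
    (e : forall x, M (vs x)) s (t : term vs s) :
  eval (fun x => g _ (e x)) t = g _ (eval e t).
Proof.
elim: t => [//|f args IH] /=; rewrite iso_fun_interp; congr fun_interp.
by apply: functional_extensionality_dep => i; exact: IH.
Qed.

Lemma sat_iso (M N : structure L) (g : iso M N) (V : Type) (vs : V -> sorts L)
    (e : forall x, M (vs x)) (phi : formula vs) :
  sat (fun x => g _ (e x)) phi <-> sat e phi.
Proof.
elim: phi e => {V vs}
  [V vs|V vs s t1 t2|V vs r args|V vs phi IH psi IH2|V vs s phi IH] e //=.
- by rewrite !eval_iso; split=> [/(bij_inj (iso_bij g s))|->].
- rewrite (iso_rel_interp g).
  suff -> : (fun i => g _ (eval e (args i))) =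
      (fun i => eval (fun x => g _ (e x)) (args i)) by [].
  by apply: functional_extensionality_dep => i; rewrite eval_iso.
- have := IH e; have := IH2 e; tauto.
- have E c : sat (env_ext (fun x => g _ (e x)) (g _ c)) phi <->
      sat (env_ext e c) phi.
    apply: (iff_trans _ (IH _)).
    set e1 := (X in sat X _ <-> _); set e2 := (X in _ <-> sat X _).
    suff -> : e1 = e2 by [].
    by apply: functional_extensionality_dep => -[x|].
  split=> H c; first by apply/E.
  by have [h _ gh] := iso_bij g s; rewrite -(gh c); apply/E.
Qed.

Definition Not (V : Type) (vs : V -> sorts L) (phi : formula vs) :=
  Imp phi (Falsum vs).

Definition And (V : Type) (vs : V -> sorts L) (phi psi : formula vs) :=
  Not (Imp phi (Not psi)).

Definition Iff (V : Type) (vs : V -> sorts L) (phi psi : formula vs) :=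
  And (Imp phi psi) (Imp psi phi).

Lemma sat_And (M : structure L) (V : Type) (vs : V -> sorts L)
    (e : forall x, M (vs x)) (phi psi : formula vs) :
  sat e (And phi psi) <-> sat e phi /\ sat e psi.
Proof.
by have [?|?] := pselect (sat e phi); have [?|?] := pselect (sat e psi);
  rewrite /=; tauto.
Qed.

Lemma sat_Iff (M : structure L) (V : Type) (vs : V -> sorts L)
    (e : forall x, M (vs x)) (phi psi : formula vs) :
  sat e (Iff phi psi) <-> (sat e phi <-> sat e psi).
Proof. by rewrite sat_And. Qed.

End Syntax.

(** * Countably many formulas *)

Lemma existT_inj (T : Type) (P : T -> Type) (x : T) (a b : P x) :
  existT P x a = existT P x b -> a = b.
Proof.
move=> e; have := projT2_eq e.
by rewrite (Prop_irrelevance (projT1_eq e) erefl).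
Qed.

Lemma countable_image (T U : Type) (f : T -> U) (A : set T) :
  countable A -> countable (f @` A).
Proof. by apply: sub_countable; exact: card_image_le. Qed.

Lemma countableS (T : Type) (A B : set T) :
  A `<=` B -> countable B -> countable A.
Proof. by move=> AB; apply: sub_countable; exact: subset_card_le. Qed.

Lemma countableU (T : Type) (A B : set T) :
  countable A -> countable B -> countable (A `|` B).
Proof.
move=> cA cB; rewrite (_ : A `|` B = \bigcup_(b : bool) (if b then A else B)).
  by apply: bigcup_countable => // -[].
apply/seteqP; split=> [x [Ax|Bx]|x [[] _ ?]].
- by exists true.
- by exists false.
- by left.
- by right.
Qed.

Lemma countable_dprod (k : nat) (X : 'I_k -> Type) (A : forall i, set (X i)) :
  (forall i, countable (A i)) ->
  countable [set a : forall i, X i | forall i, A i (a i)].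
Proof.
move=> cA; have /cid2[c _ cP] : exists2 c : forall i, X i -> nat, True &
    forall i, {in A i &, injective (c i)}.
  have H i : {c : X i -> nat | {in A i &, injective c}}.
    by apply: cid; apply/countable_injP.
  by exists (fun i => sval (H i)) => // i; exact: svalP (H i).
apply/countable_injP; exists (fun a => pickle [ffun i => c i (a i)]) => a b.
rewrite !inE => Aa Ab /(pcan_inj pickleK)/ffunP E.
apply: functional_extensionality_dep => i; apply: (cP i); rewrite ?inE //.
by have := E i; rewrite !ffunE.
Qed.

Section CountableSyntax.
Variables (L : language) (hL : countable_language L).

Section Terms.
Variables (V : Type) (vs : V -> sorts L) (B : set V).
Hypothesis cB : countable B.

(** Bounding the height makes the terms of height n + 1 images of finite
    products of terms of height n. *)
Fixpoint term_level (n : nat) (s : sorts L) (t : term vs s) : Prop :=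
  match t with
  | Var x => B x
  | App f args =>
      if n is n'.+1 then forall i, term_level n' (args i) else False
  end.

Lemma term_levelS n m s (t : term vs s) :
  (n <= m)%N -> term_level n t -> term_level m t.
Proof.
elim: t n m => [x|f args IH] [|n] [|m] //= nm H i.
exact: (IH i n m nm (H i)).
Qed.

Lemma term_over_level s (t : term vs s) :
  term_over B t -> exists n, term_level n t.
Proof.
elim: t => [x Bx|f args IH /= Bargs]; first by exists 0.
have /choice[n nP] := fun i => IH i (Bargs i).
exists (\max_i n i).+1 => i; exact: term_levelS (leq_bigmax i) (nP i).
Qed.

Lemma countable_term_level n :
  countable [set x : {s & term vs s} | term_level n (projT2 x)].
Proof.
elim: n => [|n IH].
  apply: (@countableS _ _ [set existT (term vs) (vs x) (Var vs x) | x in B]).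
    by move=> [s [x|f args]] //= Bx; exists x.
  exact: countable_image.
have cn s : countable [set t : term vs s | term_level n t].
  have /countable_injP[c cP] := IH; apply/countable_injP.
  exists (fun t => c (existT _ s t)) => t u; rewrite !inE => tn un e.
  by apply: existT_inj; apply: cP; rewrite ?inE.
apply: (@countableS _ _ ([set existT (term vs) (vs x) (Var vs x) | x in B] `|`
  \bigcup_(f in [set: funs L])
    [set existT (term vs) (fcod f) (App args) | args in
      [set args : forall i, term vs (fdom (f := f) i) |
         forall i, term_level n (args i)]])).
  move=> [s [x|f args]] /= H; [by left; exists x|right; exists f => //].
  by exists args.
apply: countableU; first exact: countable_image.
have [_ cf _] := hL; apply: bigcup_countable => // f _.
by apply: countable_image; exact: (countable_dprod (fun i => cn _)).
Qed.

Lemma countable_term s : countable [set t : term vs s | term_over B t].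
Proof.
have cn : countable (\bigcup_(n in [set: nat])
    [set x : {s & term vs s} | term_level n (projT2 x)]).
  by apply: bigcup_countable => // n _; exact: countable_term_level.
have /countable_injP[c cP] := cn; apply/countable_injP.
exists (fun t => c (existT _ s t)) => t u; rewrite !inE => tn un e.
apply: existT_inj; apply: cP => //; rewrite inE.
  by have [n] := term_over_level tn; exists n.
by have [n] := term_over_level un; exists n.
Qed.

End Terms.

Fixpoint level (n : nat) (V : Type) (vs : V -> sorts L) (B : set V)
    (phi : formula vs) : Prop :=
  match phi with
  | Falsum => True
  | Equal _ t1 t2 => term_over B t1 /\ term_over B t2
  | Rel r args => forall i, term_over B (args i)
  | Imp phi psi =>
      if n is n'.+1 then level n' B phi /\ level n' B psi else False
  | All _ phi => if n is n'.+1 then level n' (ctx_ext_set B) phi else False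
  end.

Lemma levelS n m (V : Type) (vs : V -> sorts L) (B : set V) (phi : formula vs) :
  (n <= m)%N -> level n B phi -> level m B phi.
Proof.
elim: phi n m B => {V vs}
  [V vs|V vs s t1 t2|V vs r args|V vs phi IH psi IH2|V vs s phi IH]
  [|n] [|m] B //= nm.
- by move=> [H1 H2]; split; [exact: (IH n m B nm H1)|exact: (IH2 n m B nm H2)].
- exact: (IH n m _ nm).
Qed.

Lemma over_level (V : Type) (vs : V -> sorts L) (B : set V) (phi : formula vs) :
  over B phi -> exists n, level n B phi.
Proof.
elim: phi B => {V vs}
  [V vs|V vs s t1 t2|V vs r args|V vs phi IH psi IH2|V vs s phi IH] B //=.
- by exists 0.
- by move=> ?; exists 0.
- by move=> ?; exists 0.
- move=> [/IH[n nP] /IH2[m mP]]; exists (maxn n m).+1; split.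
    exact: levelS (leq_maxl n m) nP.
  exact: levelS (leq_maxr n m) mP.
- by move=> /IH[n nP]; exists n.+1.
Qed.

Lemma countable_level n (V : Type) (vs : V -> sorts L) (B : set V) :
  countable B -> countable [set phi : formula vs | level n B phi].
Proof.
have [cs cf cr] := hL.
elim: n V vs B => [|n IH] V vs B cB.
all: pose Terms s := [set t : term vs s | term_over B t].
all: have cE : countable (\bigcup_(s in [set: sorts L])
    [set Equal p.1 p.2 | p in Terms s `*` Terms s])
  by apply: bigcup_countable => // s _; apply: countable_image;
    apply: countableX; exact: countable_term.
all: have cR : countable (\bigcup_(r in [set: rels L]) [set Rel args | args in
    [set args : forall i, term vs (rdom (r := r) i) |
       forall i, Terms _ (args i)]])
  by apply: bigcup_countable => // r _; apply: countable_image;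
    apply: (@countable_dprod _ _ (fun i => Terms (rdom (r := r) i))) => i;
    exact: countable_term.
all: have c0 := countableU (countableU (countable1 (Falsum vs)) cE) cR.
  apply: countableS c0 => -[|s t1 t2|r args|phi psi|s phi] //=.
  - by left; left.
  - by move=> [H1 H2]; left; right; exists s => //; exists (t1, t2).
  - by move=> H; right; exists r => //; exists args.
have cI : countable [set Imp p.1 p.2 | p in
    [set phi : formula vs | level n B phi] `*`
    [set phi : formula vs | level n B phi]].
  by apply: countable_image; apply: countableX; exact: IH.
have cA : countable (\bigcup_(s in [set: sorts L]) [set All phi | phi in
    [set phi : formula (ctx_ext vs s) | level n (ctx_ext_set B) phi]]).
  apply: bigcup_countable => // s _; apply: countable_image; apply: IH.
  apply: (@countableS _ _ (Some @` B `|` [set None])).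
    by move=> [x|] /=; [left; exists x|right].
  by apply: countableU => //; exact: countable_image.
apply: countableS (countableU (countableU c0 cI) cA).
move=> [|s t1 t2|r args|phi psi|s phi] //=.
- by left; left; left; left.
- by move=> [H1 H2]; left; left; left; right; exists s => //; exists (t1, t2).
- by move=> H; left; left; right; exists r => //; exists args.
- by move=> [H1 H2]; left; right; exists (phi, psi).
- by move=> H; right; exists s => //; exists phi.
Qed.

Lemma countable_over (V : Type) (vs : V -> sorts L) (B : set V) :
  countable B -> countable [set phi : formula vs | over B phi].
Proof.
move=> cB.
apply: (@countableS _ _ (\bigcup_(n in [set: nat])
  [set phi : formula vs | level n B phi])).
  by move=> phi /over_level[n]; exists n.
by apply: bigcup_countable => // n _; exact: countable_level.
Qed.

End CountableSyntax.

(** * Saturation in many variables *)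

Section Update.
Variables (V : Type) (T : V -> Type).

Definition upd (e : forall x, T x) (z : V) (c : T z) (x : V) : T x :=
  match pselect (z = x) with
  | left E => eq_rect z T c x E
  | right _ => e x
  end.

Lemma upd_eq e z c : upd e c z = c :> T z.
Proof.
by rewrite /upd; case: pselect => // E; rewrite (Prop_irrelevance E erefl).
Qed.

Lemma upd_neq e z (c : T z) x : z <> x -> upd e c x = e x.
Proof. by rewrite /upd; case: pselect. Qed.

End Update.

Section Quantify.
Variables (L : language) (C : structure L) (V : Type) (vs : V -> sorts L).

(** Substituting along [fresh_for z] replaces z by the variable that a
    quantifier would bind. *)
Definition fresh_for (z x : V) : term (ctx_ext vs (vs z)) (vs x) :=
  upd (fun x => Var (ctx_ext vs (vs z)) (Some x))
      (Var (ctx_ext vs (vs z)) None) x.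

Lemma sat_fresh (z : V) (phi : formula vs) (e : forall x, C (vs x))
    (c : C (vs z)) :
  sat (env_ext e c) (subst (fresh_for z) phi) <-> sat (upd e c) phi.
Proof.
rewrite sat_subst.
set e1 := (X in sat X _ <-> _); suff -> : e1 = upd e c by [].
apply: functional_extensionality_dep => x; rewrite /e1 /fresh_for.
have [E|zx] := pselect (z = x); last by rewrite !upd_neq.
by case: x / E; rewrite !upd_eq.
Qed.

(** The formula psi quantifies phi existentially over the variables in F, while
    these variables stay in its context. *)
Lemma finite_exists (F : set V) (phi : formula vs) : finite_set F ->
  exists psi : formula vs, forall e : forall x, C (vs x),
    sat e psi <-> exists e', (forall x, ~ F x -> e' x = e x) /\ sat e' phi.
Proof.
move=> Ffin; elim/finite_set_ind: F / Ffin => [|z F _ [psi psiP]].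
  exists phi => e; split=> [?|[e' [ee' phie']]]; first by exists e.
  suff -> : e = e' by [].
  by apply: functional_extensionality_dep => x; rewrite ee'.
exists (Not (All (Not (subst (fresh_for z) psi)))) => e; split.
  move=> /= /existsNP[c /contrapT]; rewrite sat_fresh => /psiP[e' [ee' phie']].
  exists e'; split=> // x /not_orP[zx Fx].
  by rewrite ee' // upd_neq // => zx'; apply: zx.
move=> [e' [ee' phie']] /= /(_ (e' z)); apply; apply/sat_fresh/psiP.
exists e'; split=> // x Fx; have [E|zx] := pselect (z = x).
  by case: x / E Fx => _; rewrite upd_eq.
by rewrite upd_neq // ee' // => -[/esym|].
Qed.

Lemma finite_conj (q : set (formula vs)) : finite_set q ->
  exists psi : formula vs, forall e : forall x, C (vs x),
    sat e psi <-> forall phi, q phi -> sat e phi.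
Proof.
move=> qfin; elim/finite_set_ind: q / qfin => [|phi q _ [psi psiP]].
  by exists (Not (Falsum vs)) => e /=; split.
exists (And phi psi) => e; rewrite sat_And psiP; split=> [[? H] _ [->|/H]|H] //.
by split=> [|psi' qpsi]; apply: H; [left|right].
Qed.

Lemma finite_over (q : set (formula vs)) : finite_set q ->
  exists2 S, finite_set S & forall phi, q phi -> over S phi.
Proof.
move=> qfin; elim/finite_set_ind: q / qfin => [|phi q _ [S Sfin SP]].
  by exists set0 => //; exact: finite_set0.
have [F [Ffin _ FP]] := over_finite (over_setT phi).
exists (F `|` S); first by rewrite finite_setU.
move=> chi [->|/SP]; last by apply: overS; exact: subsetUr.
by apply: overS FP; exact: subsetUl.
Qed.

End Quantify.

Section ManyVariables.
Variables (K : Type) (L : language) (C : structure L).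
Hypothesis Csat : saturated K C.
Variables (V : Type) (vs : V -> sorts L) (smallV : small K V).

Definition agrees (A : set {x & C (vs x)}) (e : forall x, C (vs x)) : Prop :=
  forall x a, A (existT _ x a) -> e x = a.

(** Take a maximal partial assignment A, compatible with G, for which every
    finite part of p is still satisfiable.  If A left out a variable z, then the
    formulas that quantify away the other unassigned variables of finite parts
    of p form a finitely satisfiable set of formulas in the single variable z,
    with the assigned values as parameters.  Saturation provides a value for z,
    which contradicts maximality. *)
Lemma saturated_family (p : set (formula vs)) (G : set {x & C (vs x)}) :
  (forall q, finite_set q -> q `<=` p ->
     exists e, agrees G e /\ forall phi, q phi -> sat e phi) ->
  exists e, agrees G e /\ forall phi, p phi -> sat e phi.
Proof.
move=> pfin.
pose P A := forall q, finite_set q -> q `<=` p ->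
  exists e, agrees (G `|` A) e /\ forall phi, q phi -> sat e phi.
have P_agrees A : P A -> exists e, agrees (G `|` A) e.
  by move=> /(_ set0 (finite_set0 _) (@sub0set _ _))[e [eA _]]; exists e.
have [F FP totF|A [PA Amax]] := @Zorn_bigcup _ P.
  set U := \bigcup_(X in F) X.
  have U_fun x a b : U (existT _ x a) -> U (existT _ x b) -> a = b.
    move=> [A FA Aa] [B FB Bb]; have [AB|BA] := totF _ _ FA FB.
      have [e eB] := P_agrees _ (FP _ FB).
      by rewrite -(eB x a) -1?(eB x b) //; right => //; exact: AB.
    have [e eA] := P_agrees _ (FP _ FA).
    by rewrite -(eA x a) -1?(eA x b) //; right => //; exact: BA.
  (* On finitely many variables, the union of the chain agrees with a member. *)
  have U_finite S : finite_set S -> exists A, P A /\ (A = set0 \/ F A) /\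
      forall x a, S x -> U (existT _ x a) -> A (existT _ x a).
    move=> Sfin; elim/finite_set_ind: S / Sfin => [|z S _ [A [PA [FA AP]]]].
      exists set0; split; first by move=> q; rewrite setU0; exact: pfin.
      by split; [left|].
    have [[a [B FB Ba]]|nU] := pselect (exists a, U (existT _ z a)); last first.
      exists A; split=> //; split=> // x a [/= xz|]; last exact: AP.
      by move=> Ux; exfalso; apply: nU; case: z / xz; exists a.
    have [B' [FB' AB' BB']] : exists B', [/\ F B', A `<=` B' & B `<=` B'].
      case: FA => [->|FA]; first by exists B; split=> //; exact: sub0set.
      by have [AB|BA] := totF _ _ FA FB; [exists B|exists A]; split.
    exists B'; split; first exact: FP.
    split; first by right.
    move=> x b [/= xz|Sx] Uxb; last by apply: AB'; exact: AP.
    case: z / xz a Ba => a Ba; apply: BB'.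
    by rewrite (U_fun x b a) //; exists B.
  move=> q qfin qp; have [S Sfin qS] := finite_over qfin.
  have [A [PA [FA AP]]] := U_finite S Sfin.
  have [e [eA eq]] := PA q qfin qp.
  pose value x (c : C (vs x)) := U (existT _ x c) \/
    (~ (exists a, U (existT _ x a)) /\ c = e x).
  have [e' e'P] : exists e', forall x, value x (e' x).
    have H x : {c | value x c}.
      apply: cid; have [[a Ua]|nU] := pselect (exists a, U (existT _ x a)).
        by exists a; left.
      by exists (e x); right.
    by exists (fun x => sval (H x)) => x; exact: svalP (H x).
  exists e'; split.
    move=> x a [Gxa|Uxa]; case: (e'P x) => [Ux|[nU ->]].
    - have [B FB Bx] := Ux; have [f fB] := P_agrees _ (FP _ FB).
      by transitivity (f x); [apply/esym|]; apply: fB; [right|left].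
    - by apply: eA; left.
    - exact: U_fun Ux Uxa.
    - by exfalso; apply: nU; exists a.
  move=> phi qphi; apply/(sat_over (e' := e) (qS _ qphi)); last exact: eq.
  move=> x Sx; case: (e'P x) => [Ux|[//]].
  by apply/esym/eA; right; exact: AP.
pose D x := exists a, (G `|` A) (existT _ x a).
have Dtot z : D z.
  apply: contrapT => nD.
  (* The values of e0 outside D are arbitrary: no formula of pz depends on
     them. *)
  have [e0 e0A] := P_agrees _ PA.
  pose free S x := [/\ S x, ~ D x & x <> z].
  pose witnessed q S (e : forall x, C (vs x)) := exists e',
    (forall x, ~ free S x -> e' x = e x) /\ forall phi, q phi -> sat e' phi.
  pose pz (theta : formula (ctx_ext vs (vs z))) := exists q S,
    [/\ finite_set q, q `<=` p, finite_set S, forall phi, q phi -> over S phi &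
    forall e (c : C (vs z)),
      sat (env_ext e c) theta <-> witnessed q S (upd e c)].
  have pz_ex q : finite_set q -> q `<=` p -> exists theta S,
      pz theta /\ forall e (c : C (vs z)),
        sat (env_ext e c) theta <-> witnessed q S (upd e c).
    move=> qfin qp; have [S Sfin qS] := finite_over qfin.
    have [chi chiP] := finite_conj C qfin.
    have [|psi psiP] := @finite_exists _ C _ _ (free S) chi.
      by apply: sub_finite_set Sfin => x [].
    have thetaP e (c : C (vs z)) :
        sat (env_ext e c) (subst (fresh_for vs z) psi) <->
        witnessed q S (upd e c).
      rewrite sat_fresh psiP; split=> -[e' [ee' /chiP e'q]]; by exists e'.
    exists (subst (fresh_for vs z) psi), S; split=> //.
    by exists q, S.
  have [|y yP] := @Csat V vs e0 (vs z) pz smallV.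
    move=> Q Qfin Qpz.
    have [q [qfin qp qQ]] : exists q, [/\ finite_set q, q `<=` p &
        forall e, (forall phi, q phi -> sat e phi) -> agrees (G `|` A) e ->
        forall theta, Q theta -> sat (env_ext e0 (e z)) theta].
      elim/finite_set_ind: Q / Qfin Qpz => [_|theta Q _ IH Qpz].
        by exists set0; split=> //; exact: finite_set0.
      have [q [qfin qp qQ]] := IH (fun _ Qx => Qpz _ (or_intror Qx)).
      have [q' [S [q'fin q'p Sfin q'S thetaP]]] := Qpz theta (or_introl erefl).
      exists (q' `|` q); split; first by rewrite finite_setU.
        by move=> phi [/q'p|/qp].
      move=> e eq eA theta' [->|]; last first.
        by apply: qQ => // phi qphi; apply: eq; right.
      apply/thetaP; have [e' e'P] : exists e', forall x,
          (S x -> e' x = e x) /\ (~ S x -> e' x = upd e0 (e z) x).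
        have H x : {c | (S x -> c = e x) /\ (~ S x -> c = upd e0 (e z) x)}.
          apply: cid; have [Sx|nSx] := pselect (S x); first by exists (e x).
          by exists (upd e0 (e z) x).
        by exists (fun x => sval (H x)) => x; exact: svalP (H x).
      exists e'; split=> [x nfree|phi q'phi]; last first.
        apply/(sat_over (e' := e) (q'S _ q'phi)) => [x Sx|].
          exact: (e'P x).1.
        by apply: eq; left.
      have [Sx|nSx] := pselect (S x); last exact: (e'P x).2.
      rewrite (e'P x).1 //; have [E|zx] := pselect (z = x).
        by case: x / E nfree Sx => _ _; rewrite upd_eq.
      rewrite upd_neq //; have [[a Aa]|nDx] := pselect (D x).
        by rewrite (eA x a) // (e0A x a).
      by exfalso; apply: nfree; split=> // /esym.
    have [e [eA eq]] := PA q qfin qp.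
    by exists (e z) => theta; exact: qQ.
  apply: (Amax (A `|` [set existT _ z y])).
    split=> [|AA]; first exact: subsetUl.
    by apply: nD; exists y; right; apply: AA; right.
  move=> q qfin qp; have [theta [S [pztheta thetaP]]] := pz_ex q qfin qp.
  have /thetaP[e' [ee' e'q]] := yP _ pztheta.
  exists e'; split=> // x a GAxa.
  have [E|zx] := pselect (z = x).
    case: x / E a GAxa => a GAza; rewrite ee' ?upd_eq; last by case.
    case: GAza => [Gza|[Aza|eay]]; last exact: esym (existT_inj eay).
      by exfalso; apply: nD; exists a; left.
    by exfalso; apply: nD; exists a; right.
  have Dx : (G `|` A) (existT _ x a).
    case: GAxa => [|[|eay]]; [by left|by right|].
    by case: zx; exact: esym (congr1 (@projT1 _ _) eay).
  rewrite ee' => [|[_ nDx _]]; last by apply: nDx; exists a.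
  by rewrite upd_neq //; exact: e0A.
have [e eA] : exists e, forall x, (G `|` A) (existT _ x (e x)).
  by exists (fun x => sval (cid (Dtot x))) => x; exact: svalP (cid (Dtot x)).
exists e; split=> [x a Gxa|phi pphi].
  have [e' e'A] := P_agrees _ PA.
  by transitivity (e' x); [apply/esym; apply: e'A|apply: e'A; left].
have [||e' [e'A /(_ phi erefl)]] := PA [set phi]; first exact: finite_set1.
  by move=> _ ->.
suff -> : e' = e by [].
by apply: functional_extensionality_dep => x; exact: e'A.
Qed.
End ManyVariables.

(** * Countable elementary substructures *)

Definition at_elements (L : language) (M : structure L) (x : elements M) :
  M (projT1 x) := projT2 x.

Section LowenheimSkolem.
Variables (L : language) (hL : countable_language L) (C : structure L).
Local Notation name := (fun x : elements C => projT1 x).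

(** Formulas with parameters in B are formulas in the context of all elements
    of C whose variables lie in B. *)
Definition tarski_vaught (B : set (elements C)) : Prop :=
  forall t (phi : formula (ctx_ext name t)), over (ctx_ext_set B) phi ->
  (exists c : C t, sat (env_ext (@at_elements L C) c) phi) ->
  exists2 c : C t, B (existT _ t c) & sat (env_ext (@at_elements L C) c) phi.

(** The countably many maps ops make it possible to close the submodel under an
    automorphism and its inverse. *)
Lemma lowenheim_skolem (B0 : set (elements C))
    (ops : nat -> elements C -> elements C) : countable B0 ->
  exists B, [/\ countable B, B0 `<=` B, forall n x, B x -> B (ops n x) &
    tarski_vaught B].
Proof.
move=> cB0; pose Theta := {t & formula (ctx_ext name t)}.
pose sat1 t (phi : formula (ctx_ext name t)) (c : C t) :=
  sat (env_ext (@at_elements L C) c) phi.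
(* The set w theta contains a witness of theta, if there is one; sets are used
   instead of elements because theta may have none. *)
have /choice[w wP] : forall theta : Theta, exists W : set (elements C),
    countable W /\ ((exists c, sat1 _ (projT2 theta) c) ->
      exists2 c, W (existT _ _ c) & sat1 _ (projT2 theta) c).
  move=> [t phi] /=.
  have [[c cphi]|n] := pselect (exists c, sat1 _ phi c).
    by exists [set existT _ t c]; split=> // _; exists c.
  by exists set0.
pose step (B : set (elements C)) := B `|` \bigcup_n (ops n @` B) `|`
  \bigcup_(theta in [set theta : Theta | over (ctx_ext_set B) (projT2 theta)])
    w theta.
pose Bn n := iter n step B0.
have cBn n : countable (Bn n).
  elim: n => [//|n IH] /=; apply: countableU.
    apply: countableU => //; apply: bigcup_countable => // k _.
    exact: countable_image.
  apply: bigcup_countable => [|theta _]; last by have [] := wP theta.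
  have [cs _ _] := hL.
  apply: (@countableS _ _ (\bigcup_(t in [set: sorts L])
    [set existT _ t phi | phi in
      [set phi : formula (ctx_ext name t) | over (ctx_ext_set (Bn n)) phi]])).
    by move=> [t phi] /= ophi; exists t => //; exists phi.
  apply: bigcup_countable => // t _; apply: countable_image.
  apply: countable_over => //.
  apply: (@countableS _ _ (Some @` Bn n `|` [set None])).
    by move=> [x|] /=; [left; exists x|right].
  by apply: countableU => //; exact: countable_image.
have Bn_mono n m : (n <= m)%N -> Bn n `<=` Bn m.
  move=> /subnK <-; elim: (m - n) => [//|k IH] x /IH Bx.
  by rewrite addSn; left; left.
exists (\bigcup_n Bn n); split.
- exact: bigcup_countable.
- by move=> x B0x; exists 0.
- move=> n x [m _ Bx]; exists m.+1 => //.
  by left; right; exists n => //; exists x.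
- move=> t phi ophi ex; have [F [Ffin FB Fphi]] := over_finite ophi.
  have [n nP] : exists n, F `<=` ctx_ext_set (Bn n).
    elim/finite_set_ind: F / Ffin FB {Fphi} => [_|o F _ IH FB].
      by exists 0.
    have [n nP] := IH (fun o Fo => FB o (or_intror Fo)).
    have [m mP] : exists m, ctx_ext_set (Bn m) o.
      have := FB o (or_introl erefl).
      by case: (o) => [x [m _ ?]|]; [exists m|exists 0].
    exists (maxn n m) => o' [->|/nP].
      by move: mP; case: (o) => //= x; apply: Bn_mono; exact: leq_maxr.
    by case: o' => //= x; apply: Bn_mono; exact: leq_maxl.
  (* phi has all its parameters at stage n, so its witness appears at n + 1. *)
  have [_ /(_ ex)[c wc cphi]] := wP (existT _ t phi).
  exists c => //; exists n.+1 => //; right; exists (existT _ t phi) => //=.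
  exact: overS nP Fphi.
Qed.

Section Substructure.
Variable B : set (elements C).
Hypothesis BTV : tarski_vaught B.

(** Witness the true formula. *)
Lemma tv_inhabited t : C t -> exists c : C t, B (existT _ t c).
Proof.
move=> c; have [||c' Bc' _] := BTV (phi := Not (Falsum (ctx_ext name t))).
- by split.
- by exists c.
- by exists c'.
Qed.

(** The value of f at a is the only witness of the formula f(a) = x. *)
Lemma tv_closed (f : funs L) (a : forall i, C (fdom (f := f) i)) :
  (forall i, B (existT _ _ (a i))) -> B (existT _ _ (fun_interp a)).
Proof.
move=> Ba.
pose fa := @App L _ (ctx_ext name (fcod f)) f
  (fun i => Var (ctx_ext name (fcod f)) (Some (existT C _ (a i)))).
have [||c Bc /= <-//] :=
  BTV (phi := Equal (Var (ctx_ext name (fcod f)) None) fa).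
- by split.
- by exists (fun_interp a).
Qed.

Definition substructure : structure L :=
  @Structure L (fun s => {a : C s | B (existT _ s a)})
    (fun f a => exist _ (fun_interp (fun i => sval (a i)))
                        (tv_closed (fun i => svalP (a i))))
    (fun r a => rel_interp (fun i => sval (a i))).

Lemma eval_substructure (V : Type) (vs : V -> sorts L)
    (e : forall x, substructure (vs x)) s (t : term vs s) :
  sval (eval e t) = eval (fun x => sval (e x)) t.
Proof.
elim: t => [//|f args IH] /=; congr fun_interp.
by apply: functional_extensionality_dep => i; exact: IH.
Qed.

(** The Tarski-Vaught test: the substructure is elementary. *)
Lemma sat_substructure (V : Type) (vs : V -> sorts L)
    (e : forall x, substructure (vs x)) (phi : formula vs) :
  sat e phi <-> sat (M := C) (fun x => sval (e x)) phi.
Proof.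
elim: phi e => {V vs}
  [V vs|V vs s t1 t2|V vs r args|V vs phi IH psi IH2|V vs s phi IH] e //=.
- rewrite -!eval_substructure; split=> [->//|].
  exact: eq_sig_hprop (fun _ => @Prop_irrelevance _) _ _.
- suff -> : (fun i => sval (eval e (args i))) =
      (fun i => eval (fun x => sval (e x)) (args i)) by [].
  by apply: functional_extensionality_dep => i; rewrite eval_substructure.
- by rewrite IH IH2.
- have E c : sat (env_ext e c) phi <->
      sat (M := C) (env_ext (fun x => sval (e x)) (sval c)) phi.
    rewrite IH; set e1 := (X in sat X _ <-> _); set e2 := (X in _ <-> sat X _).
    suff -> : e1 = e2 by [].
    by apply: functional_extensionality_dep => -[x|].
  split=> H c; last exact/E/H.
  apply: contrapT => nphi.
  (* View the values of e as parameters, to turn phi into a formula over B. *)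
  pose sigma (o : option V) : term (ctx_ext name s) (ctx_ext vs s o) :=
    match o with
    | Some x => Var (ctx_ext name s) (Some (existT C (vs x) (sval (e x))))
    | None => Var (ctx_ext name s) None
    end.
  have satE c' : sat (env_ext (@at_elements L C) c') (subst sigma phi) <->
      sat (M := C) (env_ext (fun x => sval (e x)) c') phi.
    rewrite sat_subst.
    set e1 := (X in sat X _ <-> _); set e2 := (X in _ <-> sat X _).
    suff -> : e1 = e2 by [].
    by apply: functional_extensionality_dep => -[x|].
  have [||c' Bc' nc'] := BTV (phi := Not (subst sigma phi)).
  + split=> //; apply: over_subst (over_setT phi) _ => -[x|] _ //=.
    exact: svalP (e x).
  + by exists c => /satE.
  + exact/nc'/satE/(E (exist _ c' Bc')).
Qed.

Lemma countable_substructure : countable B -> countable_structure substructure.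
Proof.
move=> /countable_injP[c cP]; apply/countable_injP.
exists (fun x : elements substructure =>
  c (existT C (projT1 x) (sval (projT2 x)))).
move=> [s [a Ba]] [t [b Bb]] _ _ /= /cP; rewrite !inE => /(_ Ba Bb) E.
move: (congr1 (@projT1 _ _) E) => /= st; case: t / st b Bb E => b Bb E.
have ab : a = b by exact: existT_inj E.
by case: b / ab Bb {E} => Bb; rewrite (Prop_irrelevance Ba Bb).
Qed.

Section Restriction.
Variable g : aut C.
Hypothesis gB : forall s (a : C s), B (existT _ s (g s a)) <-> B (existT _ s a).

Lemma aut_restriction :
  exists h : aut substructure, forall s a, sval (h s a) = g s (sval a).
Proof.
pose h s (a : substructure s) : substructure s :=
  exist _ (g s (sval a)) ((gB (sval a)).2 (svalP a)).
have hbij s : bijective (h s).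
  have kB (a : substructure s) : B (existT _ s (aut_inv g s (sval a))).
    by apply/gB; rewrite /= aut_invKV; exact: (svalP a).
  pose k (a : substructure s) : substructure s := exist _ _ (kB a).
  exists k => a; apply: (eq_sig_hprop (fun _ => @Prop_irrelevance _)) => /=.
    by rewrite aut_invK.
  by rewrite aut_invKV.
have hfun (f : funs L) (a : forall i, substructure (fdom (f := f) i)) :
    h _ (fun_interp a) = fun_interp (fun i => h _ (a i)).
  apply: (eq_sig_hprop (fun _ => @Prop_irrelevance _)) => /=.
  exact: iso_fun_interp.
have hrel (r : rels L) (a : forall i, substructure (rdom (r := r) i)) :
    rel_interp a <-> rel_interp (fun i => h _ (a i)).
  exact: (iso_rel_interp g).
by exists (Iso hbij hfun hrel).
Qed.

End Restriction.

End Substructure.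
End LowenheimSkolem.

(** * Isomorphisms, reducts and constants *)

Local Obligation Tactic := idtac.

Section IsoTransport.
Variables (L : language).

Lemma iso_inverse (M N : structure L) (f : iso M N) :
  exists2 k : iso N M,
    (forall s, cancel (f s) (k s)) & (forall s, cancel (k s) (f s)).
Proof.
have [k kP] : exists k : forall s, N s -> M s,
    forall s, cancel (f s) (k s) /\ cancel (k s) (f s).
  have H s : {k | cancel (f s) k /\ cancel k (f s)}.
    by apply: cid; case: (iso_bij f s) => k; exists k.
  by exists (fun s => sval (H s)) => s; exact: (svalP (H s)).
have fK s := (kP s).1; have kK s := (kP s).2.
have kfun (h : funs L) a :
    k _ (fun_interp (f := h) a) = fun_interp (fun i => k _ (a i)).
  apply: (can_inj (fK _)); rewrite kK iso_fun_interp; congr fun_interp.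
  by apply: functional_extensionality_dep => i; rewrite kK.
have krel (r : rels L) a :
    rel_interp (r := r) a <-> rel_interp (fun i => k _ (a i)).
  rewrite [X in _ <-> X](iso_rel_interp f).
  have -> // : (fun i => f _ (k _ (a i))) = a.
  by apply: functional_extensionality_dep => i; rewrite kK.
have kbij s : bijective (k s) by exists (f s).
by exists (Iso kbij kfun krel).
Qed.

Program Definition iso_comp (M N P : structure L) (g : iso N P) (f : iso M N) :
    iso M P :=
  @Iso L M P (fun s a => g s (f s a)) _ _ _.
Next Obligation.
by move=> M N P g f s; exact: (bij_comp (iso_bij g s) (iso_bij f s)).
Qed.
Next Obligation. by move=> M N P g f h a /=; rewrite !iso_fun_interp. Qed.
Next Obligation.
by move=> M N P g f r a /=; rewrite (iso_rel_interp f) (iso_rel_interp g).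
Qed.

(** Conjugation by f is an isomorphism of topological groups, along which
    actions are pulled back. *)
Lemma extremely_amenable_iso (M N : structure L) (f : iso M N) :
  extremely_amenable (aut M) -> extremely_amenable (aut N).
Proof.
move=> EA X act X0 Xc Xh [act1 actM actc].
have [k fK kK] := iso_inverse f.
pose conj (g : aut M) : aut N := iso_comp f (iso_comp g k).
have conj1 : conj 1%g = 1%g by apply: aut_ext => s a /=; rewrite kK.
have conjM g h : conj (g * h)%g = (conj g * conj h)%g.
  by apply: aut_ext => s a /=; rewrite fK.
have conj_cont : continuous conj.
  move=> g; apply/(cvg_autP _ (fmap_filter _ (nbhs_filter g))) => s a.
  have := @nbhs_aut _ _ g s (k s a).
  by apply: (@filterS _ _ (nbhs_filter g)) => h /= ->.
have [|x fx] := EA X (fun g x => act (conj g) x) X0 Xc Xh.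
  split=> [x|g h x|]; [by rewrite conj1|by rewrite conjM|].
  move=> [g x].
  apply: (@continuous_comp _ _ _ (fun p : aut M * X => (conj p.1, p.2))
    (fun p : aut N * X => act p.1 p.2)); last exact: actc.
  have c1 : conj p.1 @[p --> (g, x)] --> conj g.
    have c0 : p.1 @[p --> (g, x)] --> g by exact: cvg_fst.
    exact: (cvg_comp _ _ c0 (conj_cont g)).
  have c2 : p.2 @[p --> (g, x)] --> x by exact: cvg_snd.
  exact: cvg_pair c1 c2.
exists x => h; rewrite -[in RHS](fx (iso_comp k (iso_comp h f))); congr act.
by apply: aut_ext => s a /=; rewrite !kK.
Qed.

End IsoTransport.

Section Constants.
Variables (L : language) (X : Type) (cs : X -> sorts L).
Local Notation L' := (add_constants cs).

Definition reduct (N : structure L') : structure L :=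
  @Structure L N (fun f => @fun_interp L' N (inl f)) (@rel_interp L' N).

Lemma reduct_expand (M : structure L) (c : forall x, M (cs x)) :
  reduct (expand c) = M.
Proof. by case: M c. Qed.

Fixpoint term_lift (V : Type) (vs : V -> sorts L) (s : sorts L)
    (t : term vs s) :
    @term L' V vs s :=
  match t in term _ s return @term L' V vs s with
  | Var x => @Var L' V vs x
  | App f args => @App L' V vs (inl f) (fun i => term_lift (args i))
  end.

Fixpoint lift (V : Type) (vs : V -> sorts L) (phi : formula vs) :
    @formula L' V vs :=
  match phi with
  | Falsum => @Falsum L' V vs
  | Equal t t1 t2 => @Equal L' V vs t (term_lift t1) (term_lift t2)
  | Rel r args => @Rel L' V vs r (fun i => term_lift (args i))
  | Imp phi psi => @Imp L' V vs (lift phi) (lift psi)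
  | All t phi => @All L' V vs t (lift phi)
  end.

Lemma eval_lift (N : structure L') (V : Type) (vs : V -> sorts L)
    (e : forall x, N (vs x)) s (t : term vs s) :
  @eval L' N V vs e s (term_lift t) = @eval L (reduct N) V vs e s t.
Proof.
elim: t => [//|f args IH] /=.
congr (@fun_interp L' N (inl f)).
by apply: functional_extensionality_dep => i; exact: IH.
Qed.

Lemma sat_lift (N : structure L') (V : Type) (vs : V -> sorts L)
    (e : forall x, N (vs x)) (phi : formula vs) :
  @sat L' N V vs e (lift phi) <-> @sat L (reduct N) V vs e phi.
Proof.
elim: phi e => {V vs}
  [V vs|V vs s t1 t2|V vs r args|V vs phi IH psi IH2|V vs s phi IH] e //=.
- by rewrite !eval_lift.
- suff -> : (fun i => @eval L' N V vs e _ (term_lift (args i))) =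
      (fun i => @eval L (reduct N) V vs e _ (args i)) by [].
  by apply: functional_extensionality_dep => i; rewrite eval_lift.
- by rewrite IH IH2.
- by split=> H c; apply/IH.
Qed.

Lemma holds_lift (N : structure L') (phi : sentence L) :
  @holds L' N (lift phi) <-> @holds L (reduct N) phi.
Proof. exact: sat_lift. Qed.

Lemma aut_of_reduct (N : structure L') (g : aut (reduct N)) :
  (forall x (a : forall i, N (@fdom L' (inr x) i)),
     g _ (@fun_interp L' N (inr x) a) = @fun_interp L' N (inr x) a) ->
  exists h : aut N, forall s a, h s a = g s a.
Proof.
move=> gc.
have hfun (f : funs L') (a : forall i, N (fdom (f := f) i)) :
    g _ (fun_interp a) = fun_interp (fun i => g _ (a i)).
  case: f a => [f|x] a; first exact: (iso_fun_interp g).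
  rewrite gc; congr fun_interp.
  by apply: functional_extensionality_dep => -[].
have hrel (r : rels L') (a : forall i, N (rdom (r := r) i)) :
    rel_interp a <-> rel_interp (fun i => g _ (a i)).
  exact: (iso_rel_interp g).
by exists (@Iso L' N N (iso_fun g) (iso_bij g) hfun hrel).
Qed.

Lemma reduct_aut (N : structure L') (g : aut N) :
  exists h : aut (reduct N), forall s a, h s a = g s a.
Proof.
pose h : forall s : sorts L, reduct N s -> reduct N s := fun s => g s.
have hfun (f : funs L) (a : forall i, reduct N (fdom (f := f) i)) :
    h _ (fun_interp a) = fun_interp (fun i => h _ (a i)).
  exact: (@iso_fun_interp L' N N g (inl f)).
have hrel (r : rels L) (a : forall i, reduct N (rdom (r := r) i)) :
    rel_interp a <-> rel_interp (fun i => h _ (a i)).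
  exact: (@iso_rel_interp L' N N g r).
by exists (@Iso L (reduct N) (reduct N) h (@iso_bij L' N N g) hfun hrel).
Qed.

End Constants.

(** * Finite patterns from extreme amenability *)

Definition pair_sort (S I : Type) (s : I -> S) (x : I + I) : S :=
  match x with inl i => s i | inr i => s i end.

Definition pair_env (S I : Type) (s : I -> S) (T : S -> Type)
    (e e' : forall i, T (s i)) (x : I + I) : T (pair_sort s x) :=
  match x with inl i => e i | inr i => e' i end.

Lemma pair_env_map (S I : Type) (s : I -> S) (T U : S -> Type)
    (f : forall t, T t -> U t) (e e' : forall i, T (s i)) :
  pair_env (fun i => f _ (e i)) (fun i => f _ (e' i)) =
  (fun x => f _ (pair_env e e' x)).
Proof. by apply: functional_extensionality_dep => -[]. Qed.

Lemma nbhs_fix_family (L : language) (M : structure L) (T : Type)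
    (u : T -> sorts L) (p : forall t, M (u t)) : finite_set [set: T] ->
  nbhs (1%g : aut M) [set g : aut M | (fun t => g _ (p t)) = p].
Proof.
move=> Tfin.
have : nbhs (1%g : aut M)
    [set g : aut M | forall t, [set: T] t -> g _ (p t) = p t].
  apply: filter_forall_finite => // t _.
  exact: (@nbhs_aut _ _ (1%g : aut M)).
apply: (@filterS _ _ (nbhs_filter (1%g : aut M))) => g /= gp.
by apply: functional_extensionality_dep => t; exact: gp.
Qed.

Section Pattern.
Variables (L : language) (hL : countable_language L).
Variables (M : structure L) (hM : countable_structure M).
Hypotheses (hcat : omega_categorical (Th M)) (hea : extremely_amenable (aut M)).
Variables (X : Type) (Xfin : finite_set [set: X]) (cs : X -> sorts L).
Local Notation L' := (add_constants cs).
Variable C : structure L'.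
Hypothesis CM : models (reduct C) (Th M).

Lemma countable_add_constants : countable_language L'.
Proof.
have [cS cF cR] := hL; split=> //=.
apply: (@countableS _ _ (inl @` [set: funs L] `|` inr @` [set: X])).
  by move=> [f|x] _; [left; exists f|right; exists x].
by apply: countableU; apply: countable_image => //; exact: finite_set_countable.
Qed.

(** By elementarity the reduct is a countable model of Th(M), so it is
    isomorphic to M by omega-categoricity. *)
Lemma extremely_amenable_substructure (B : set (elements C))
    (BTV : tarski_vaught B) :
  countable B -> extremely_amenable (aut (reduct (substructure BTV))).
Proof.
move=> cB; set N := substructure BTV.
have NM : models (reduct N) (Th M).
  move=> phi /CM /(@sat_lift L X cs C) phiC.
  apply/(@sat_lift L X cs N)/sat_substructure; move: phiC.
  set e1 := (X in sat X _ -> _); set e2 := (X in _ -> sat X _).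
  by suff -> : e1 = e2 by []; apply: functional_extensionality_dep => -[].
have [M0 [_ _ M0_iso]] := hcat.
have [f] := M0_iso M hM (fun _ => id).
have [h] := M0_iso (reduct N) (countable_substructure BTV cB) NM.
have [k _ _] := iso_inverse f.
exact: extremely_amenable_iso (iso_comp h k) hea.
Qed.

(** Only the finitely many coordinates F of the index set I that occur in Phi
    matter, and the coordinates of a in F generate a countable elementary
    substructure N, closed under g.  In N the truth values v are provided by
    [invariant_truth_value] for the orbit of a restricted to F under the
    automorphisms fixing the constants; this orbit also contains g a.  The c n
    are then chosen one after the other. *)
Lemma finite_pattern (I : Type) (s : I -> sorts L') (a : forall i, C (s i))
    (g : aut C) (Phi : set (formula (pair_sort s))) : finite_set Phi ->
  exists (c : nat -> forall i, C (s i)) (v : formula (pair_sort s) -> Prop),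
  forall phi, Phi phi ->
    (forall k l, (k < l)%N -> sat (pair_env (c k) (c l)) phi <-> v phi) /\
    (forall l, (sat (pair_env a (c l)) phi <-> v phi) /\
               (sat (pair_env (fun i => g _ (a i)) (c l)) phi <-> v phi)).
Proof.
move=> Phifin; have [S Sfin SPhi] := finite_over Phifin.
pose F i := S (inl i) \/ S (inr i).
have Ffin : finite_set F.
  rewrite (_ : F = inl @^-1` S `|` inr @^-1` S) // finite_setU.
  by split; apply: finite_preimage => // x y _ _ [].
pose B0 : set (elements C) := [set existT C (s i) (a i) | i in F].
pose op (h : aut C) (x : elements C) : elements C :=
  existT C (projT1 x) (h _ (projT2 x)).
have [|B [cB B0B Bop BTV]] := @lowenheim_skolem L' countable_add_constants C B0
    (fun n => if n is 0 then op g else op (g^-1)%g).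
  by apply: countable_image; exact: finite_set_countable.
have gB t (b : C t) : B (existT _ t (g t b)) <-> B (existT _ t b).
  split=> [/(Bop 1)|/(Bop 0)] //=; by rewrite /op /= aut_invK.
pose N := substructure BTV.
have EA := @extremely_amenable_substructure B BTV cB.
have [gN gNE] := aut_restriction BTV gB.
have [g0 g0E] := reduct_aut gN.
(* Outside F the coordinates of a need not lie in N: replace them by any
   elements of N of the right sorts. *)
have [a0 a0E] : exists a0 : forall i, N (s i),
    forall i, F i -> sval (a0 i) = a i.
  have H i : {b : N (s i) | F i -> sval b = a i}.
    apply: cid; have [Fi|nFi] := pselect (F i).
      by exists (exist _ (a i) (B0B _ (ex_intro2 _ _ i Fi erefl))).
    by have [b Bb] := tv_inhabited BTV (a i); exists (exist _ b Bb).
  by exists (fun i => sval (H i)) => i; exact: (svalP (H i)).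
(* A constant is a function without arguments; zN is its empty argument list. *)
have zN : forall x (i : 'I_(@farity L' (inr x))), N (fdom i) by move=> x [].
pose k0 (x : X) : reduct N (cs x) := @fun_interp L' N (inr x) (zN x).
pose G : topologicalGroupType := aut (reduct N).
pose actK (h : G) (k : forall x, reduct N (cs x)) x := h _ (k x).
pose P := forall i : {i | F i}, reduct N (s (sval i)).
pose actP (h : G) (p : P) : P := fun i => h _ (p i).
pose res (e : forall i, N (s i)) : P := fun i => e (sval i).
pose R (phi : formula (pair_sort s)) (p q : P) := over S phi /\
  exists e e', [/\ res e = p, res e' = q & sat (M := N) (pair_env e e') phi].
have stab_aut (h : G) : actK h k0 = k0 ->
    exists h' : aut N, forall t b, h' t b = h t b.
  move=> hk; apply: aut_of_reduct => x b.
  have -> : b = zN x by apply: functional_extensionality_dep => -[].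
  exact: (congr1 (fun f => f x) hk).
have RE phi e e' : Phi phi ->
    R phi (res e) (res e') <-> sat (M := N) (pair_env e e') phi.
  move=> /SPhi oS; split=> [[_ [e1 [e1' [er er' ]]]]|]; last first.
    by split=> //; exists e, e'.
  apply: (sat_over oS _).1 => -[i|i] Si /=.
    exact: (congr1 (fun f => f (exist _ i (or_introl Si))) er).
  exact: (congr1 (fun f => f (exist _ i (or_intror Si))) er').
have [| | | | | | |v vP] :=
  @invariant_truth_value G _ P _ actK actP k0 (res a0) R EA.
- by [].
- by [].
- by move=> k; exact: nbhs_fix_family.
- by [].
- by [].
- move=> p; apply: nbhs_fix_family.
  have := @finite_preimage {i | F i} I F sval.
  rewrite (_ : sval @^-1` F = setT); last by apply/seteqP; split=> // -[].
  by apply=> // x y _ _; exact: (eq_sig_hprop (fun _ => @Prop_irrelevance _)).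
- move=> h phi p q /stab_aut[h' h'E] [oS [e [e' [ep e'q eephi]]]]; split=> //.
  exists (fun i => h' _ (e i)), (fun i => h' _ (e' i)); split.
  + by apply: functional_extensionality_dep => i; rewrite /res h'E -ep.
  + by apply: functional_extensionality_dep => i; rewrite /res h'E -e'q.
  + by rewrite pair_env_map sat_iso.
set orbit := [set _ | _ in _] in vP.
have [next nextP] : exists next : set P -> P,
    forall T, finite_set T -> T `<=` orbit -> orbit (next T) /\
      forall phi p, Phi phi -> T p -> R phi p (next T) <-> v phi.
  have H T : {c | finite_set T -> T `<=` orbit ->
      orbit c /\ forall phi p, Phi phi -> T p -> R phi p c <-> v phi}.
    apply: cid.
    have [Tfin|nT] := pselect (finite_set T); last by exists (res a0) => /nT.
    have [To|nT] := pselect (T `<=` orbit); last by exists (res a0) => _ /nT.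
    have [||c oc cP] := vP (Phi `*` T); first exact: finite_setX.
      by move=> phi p [_ /To].
    by exists c => _ _; split=> // phi p Pphi Tp; apply: cP.
  by exists (fun T => sval (H T)) => T; exact: (svalP (H T)).
pose ga0 i := g0 (s i) (a0 i).
pose T0 : set P := [set res a0; res ga0].
(* T n collects a, g a and the tuples chosen before step n, restricted to F. *)
pose T := fix T n := if n is n'.+1 then next (T n') |` T n' else T0.
have TP n : finite_set (T n) /\ T n `<=` orbit.
  elim: n => [|n [Tfin To]].
    split; first exact: finite_set2.
    move=> _ [->|->].
      by exists 1%g.
    exists g0 => //.
    apply: functional_extensionality_dep => x; rewrite /actK g0E /k0.
    apply: (etrans (@iso_fun_interp L' N N gN (inr x) (zN x))).
    by congr fun_interp; apply: functional_extensionality_dep => -[].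
  split; first by rewrite /= finite_setU; split=> //; exact: finite_set1.
  by move=> _ /= [->|/To //]; exact: (nextP _ Tfin To).1.
have nextT n := nextP _ (TP n).1 (TP n).2.
(* The orbit consists of restrictions of tuples indexed by all of I. *)
have [c0 c0E] : exists c0 : nat -> forall i, N (s i),
    forall n, res (c0 n) = next (T n).
  have H n : {e | res e = next (T n)}.
    by apply: cid; have [[h _ <-] _] := nextT n; exists (fun i => h _ (a0 i)).
  by exists (fun n => sval (H n)) => n; exact: (svalP (H n)).
have T_mono k l : (k <= l)%N -> T k `<=` T l.
  move=> /subnK <-; elim: (l - k) => [//|m IH] x /IH Tx.
  by rewrite addSn; right.
have satC phi e e' :
    sat (M := C) (pair_env (fun i => sval (e i)) (fun i => sval (e' i))) phi <->
    sat (M := N) (pair_env e e') phi.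
  rewrite sat_substructure; set e1 := (X in sat X _ <-> _).
  set e2 := (X in _ <-> sat X _); suff -> : e1 = e2 by [].
  by apply: functional_extensionality_dep => -[].
have T0T l : T0 `<=` T l by exact: (T_mono 0).
exists (fun n i => sval (c0 n i)), v => phi Pphi; split=> [k l kl|l].
  rewrite satC -RE // !c0E; apply: (nextT l).2 => //.
  by apply: (T_mono k.+1) => //=; left.
have [_ /(_ phi)] := nextT l; rewrite -c0E => vl; split.
  rewrite -(vl (res a0) Pphi); last by apply: T0T; left.
  rewrite RE // -satC; apply: sat_over (SPhi _ Pphi) _ => -[i|i] Si //=.
  by rewrite a0E //; left.
rewrite -(vl (res ga0) Pphi); last by apply: T0T; right.
rewrite RE // -satC; apply: sat_over (SPhi _ Pphi) _ => -[i|i] Si //=.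
by rewrite /ga0 g0E gNE a0E //; left.
Qed.

End Pattern.

(** * From finite patterns to Lascar equivalence *)

Lemma strict_total_order (W : Type) : exists lt : W -> W -> Prop,
  [/\ forall x, ~ lt x x, forall x y z, lt x y -> lt y z -> lt x z &
      forall x y, x <> y -> lt x y \/ lt y x].
Proof.
have [R Rwo] := well_ordering_principle {classic W}.
have Rch : wo_chain R predT by move=> A _; exact: Rwo.
have Rtot x y : R x y || R y x by exact: (wo_chainW Rch).
have Ranti x y : R x y -> R y x -> x = y.
  by move=> xy yx; apply: (wo_chain_antisymmetric Rch) => //; rewrite xy yx.
have Rtrans x y z : R x y -> R y z -> R x z.
  move=> xy yz; have [|m [[+ mlb] _]] := Rwo (mem [:: x; y; z]).
    by exists x; rewrite inE eqxx.
  have [mx my mz] : [/\ R m x, R m y & R m z].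
    by split; apply: mlb; rewrite !inE eqxx ?orbT.
  rewrite !inE => /or3P[]/eqP Em; subst m => //.
    by rewrite (Ranti x y).
  by rewrite -(Ranti y z).
exists (fun x y => R x y /\ x <> y); split.
- by move=> x [].
- move=> x y z [xy nxy] [yz nyz]; split; first exact: Rtrans yz.
  by move=> xz; subst z; apply: nxy; exact: Ranti.
- by move=> x y nxy; have /orP[] := Rtot x y; [left|right; split=> // /esym].
Qed.

(** Count the elements of S below w. *)
Lemma finite_rank (W : Type) (lt : W -> W -> Prop) (S : set W) :
  (forall x, ~ lt x x) -> (forall x y z, lt x y -> lt y z -> lt x z) ->
  finite_set S ->
  exists r : W -> nat, forall w w', S w -> lt w w' -> (r w < r w')%N.
Proof.
elim/Peq: W => W in lt S *; move=> ltxx lttr /finite_seqP[l ->].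
exists (fun w => count (fun v => `[< lt v w >]) l) => w w' /= wl ww'.
have sub v : `[< lt v w >] -> `[< lt v w' >].
  by move=> /asboolP vw; apply/asboolP; exact: lttr ww'.
elim: l wl => [//|v l IH]; rewrite inE => /predU1P[<-|/IH] /=.
  have -> : `[< lt w w >] = false by apply/asboolP.
  have -> : `[< lt w w' >] by apply/asboolP.
  by rewrite add0n add1n ltnS; exact: sub_count.
move=> H; rewrite -addnS; apply: leq_add => //.
by case: (`[< lt v w >]) (sub v) => // ->.
Qed.

Section IndiscernibleArray.
Variables (K : Type) (L : language) (C : structure L).
Hypotheses (Klim : strong_limit K) (Csat : saturated K C).
Hypothesis Chom : strongly_homogeneous K C.
Variables (I : Type) (s : I -> sorts L) (Ismall : small K I).
Variables (a b : forall i, C (s i)).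
Hypothesis pattern : forall Phi : set (formula (pair_sort s)), finite_set Phi ->
  exists (c : nat -> forall i, C (s i)) (v : formula (pair_sort s) -> Prop),
  forall phi, Phi phi ->
    (forall k l, (k < l)%N -> sat (pair_env (c k) (c l)) phi <-> v phi) /\
    (forall l, (sat (pair_env a (c l)) phi <-> v phi) /\
               (sat (pair_env b (c l)) phi <-> v phi)).

(** The requirements on c form a set of formulas in W * I variables with
    parameters a and b.  A finite part of it mentions finitely many formulas and
    finitely many w, so [pattern] applies, with each w sent to its rank. *)
Lemma pattern_realized (W : Type) (lt : W -> W -> Prop) : small K W ->
  (forall x, ~ lt x x) -> (forall x y z, lt x y -> lt y z -> lt x z) ->
  exists c : W -> forall i, C (s i),
    (forall w, same_type (pair_env a (c w)) (pair_env b (c w))) /\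
    (forall w w', lt w w' ->
       same_type (pair_env (c w) (c w')) (pair_env a (c w'))).
Proof.
move=> Wsmall ltxx lttr.
pose V := (I + I + W * I)%type.
pose vs (x : V) := match x with inl y => pair_sort s y | inr p => s p.2 end.
have Vsmall : small K V.
  by apply: small_sum => //; [exact: small_sum|exact: small_prod].
pose ta i : term vs (s i) := Var vs (inl (inl i)).
pose tb i : term vs (s i) := Var vs (inl (inr i)).
pose tw w i : term vs (s i) := Var vs (inr (w, i)).
pose at_pair (t t' : forall i, term vs (s i)) phi := subst (pair_env t t') phi.
have sat_pair e t t' phi : sat (M := C) e (at_pair t t' phi) <->
    sat (pair_env (fun i => eval e (t i)) (fun i => eval e (t' i))) phi.
  by rewrite sat_subst -pair_env_map.
pose Sigma phi w w' psi :=
  psi = Iff (at_pair ta (tw w') phi) (at_pair tb (tw w') phi) \/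
  lt w w' /\ psi = Iff (at_pair (tw w) (tw w') phi) (at_pair ta (tw w') phi).
pose G : set {x & C (vs x)} := [set x | exists i,
  x = existT _ (inl (inl i)) (a i) \/ x = existT _ (inl (inr i)) (b i)].
pose p psi := exists phi w w', Sigma phi w w' psi.
have [q qfin qp|e [eG ep]] := @saturated_family K L C Csat V vs Vsmall p G.
  have [Phi [S [Phifin Sfin qPS]]] : exists Phi S,
      [/\ finite_set Phi, finite_set S & forall psi, q psi ->
          exists phi w w', [/\ Phi phi, S w & Sigma phi w w' psi]].
    elim/finite_set_ind: q / qfin qp => [_|psi q _ IH qp].
      by exists set0, set0; split=> //; exact: finite_set0.
    have [Phi [S [Phifin Sfin qPS]]] := IH (fun _ Qx => qp _ (or_intror Qx)).
    have [phi [w [w' pww']]] := qp psi (or_introl erefl).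
    exists (phi |` Phi), (w |` S).
    split; rewrite ?finite_setU; [by split|by split|].
    move=> psi' [->|/qPS[phi' [v [v' [Pphi' Sv H]]]]].
      by exists phi, w, w'; split=> //; left.
    by exists phi', v, v'; split=> //; right.
  have [c [v cv]] := pattern Phifin.
  have [r rP] := finite_rank ltxx lttr Sfin.
  pose e (x : V) : C (vs x) := match x with
    | inl y => pair_env a b y
    | inr p => c (r p.1) p.2
    end.
  exists e; split.
    suff H y : G y -> e (projT1 y) = projT2 y by move=> x d /H.
    by move=> [i [->|->]].
  move=> psi /qPS[phi [w [w' [Pphi Sw]]]].
  have [cc ac] := cv phi Pphi; have [acl bcl] := ac (r w').
  move=> [->|[ww' ->]]; apply/sat_Iff; rewrite !sat_pair /=.
    by rewrite acl bcl.
  by rewrite acl cc //; exact: rP.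
have ea i : e (inl (inl i)) = a i by apply: eG; exists i; left.
have eb i : e (inl (inr i)) = b i by apply: eG; exists i; right.
have {}ea : (fun i => eval e (ta i)) = a.
  exact: functional_extensionality_dep.
have {}eb : (fun i => eval e (tb i)) = b.
  exact: functional_extensionality_dep.
exists (fun w i => e (inr (w, i))); split=> [w phi|w w' ww' phi].
  have : sat e (Iff (at_pair ta (tw w) phi) (at_pair tb (tw w) phi)).
    by apply: ep; exists phi, w, w; left.
  by rewrite sat_Iff !sat_pair ea eb.
have : sat e (Iff (at_pair (tw w) (tw w') phi) (at_pair ta (tw w') phi)).
  by apply: ep; exists phi, w, w'; right.
by rewrite sat_Iff !sat_pair ea.
Qed.

(** The index set W is the powerset of the set of E-classes, which is small
    since the cardinal of K is a strong limit, and too large for the classes of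
    the c w to be distinct. *)
Lemma pattern_E_L : E_L K a b.
Proof.
move=> E Eeq Einv Ebd.
have E_transfer x y x' y' :
    same_type (pair_env x y) (pair_env x' y') -> E x y -> E x' y'.
  move=> /(Chom (small_sum Klim Ismall Ismall))[h hP] /(Einv h).
  have -> : (fun i => h _ (x i)) = x'.
    by apply: functional_extensionality_dep => i; exact: (hP (inl i)).
  have -> // : (fun i => h _ (y i)) = y'.
  by apply: functional_extensionality_dep => i; exact: (hP (inr i)).
pose classes := [set X | exists x : forall i, C (s i), X = [set y | E x y]].
pose Z := {X | classes X}.
have Zsmall : small K Z.
  apply: (@small_inj_into K Z _ classes sval) Ebd.
    by move=> x y; exact: (eq_sig_hprop (fun _ => @Prop_irrelevance _)).
  by move=> _ [x _ <-]; exact: svalP.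
have [lt [ltxx lttr lttot]] := strict_total_order (set Z).
have [c [cab cc]] := pattern_realized (small_set Klim Zsmall) ltxx lttr.
pose f (w : set Z) : Z :=
  exist _ [set y | E (c w) y] (ex_intro _ (c w) erefl).
have [w [w' [ww' fww']]] : exists w w', lt w w' /\ f w = f w'.
  apply: contrapT => H; apply: (@no_inj_powerset Z f) => w w' fww'.
  apply: contrapT => /lttot[ww'|w'w]; apply: H; first by exists w, w'.
  by exists w', w.
have Ecc : E (c w) (c w').
  have : [set y | E (c w) y] = [set y | E (c w') y] := congr1 sval fww'.
  by move=> /(congr1 (fun F => F (c w'))) /= ->; reflexivity.
have Eac := E_transfer _ _ _ _ (cc _ _ ww') Ecc.
have Ebc := E_transfer _ _ _ _ (cab w') Eac.
by transitivity (c w') => //; symmetry.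
Qed.

End IndiscernibleArray.

Theorem corollary1p8 (L : language) (M : structure L)
    (hL : countable_language L) (hM : countable_structure M)
    (hcat : omega_categorical (Th M))
    (hea : extremely_amenable (aut M)) :
  G_trivial (Th M).
Proof.
move=> K0 C0 _ C0M A Afin K C [Klim _ Csat Chom] CT.
have Xfin : finite_set [set: A].
  have := @finite_preimage A (elements C0) A val.
  rewrite (_ : val @^-1` A = setT); last first.
    by apply/seteqP; split=> // x _; exact: set_valP.
  by apply=> // x y _ _; exact: val_inj.
have CM : models (reduct C) (Th M).
  move=> phi /C0M C0phi; apply/(@holds_lift L A _ C)/CT/holds_lift.
  by rewrite reduct_expand.
have full g : Autf_L K C g.
  move=> I s a Ismall; apply: pattern_E_L => // Phi Phifin.
  exact: (finite_pattern hL hM hcat hea Xfin CM a g Phifin).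
by apply/seteqP; split=> [_ [g _ <-]|_ ->];
  [apply/seteqP; split=> h _; exact: full|exists 1%g].
Qed.
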